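(* Let $n\ge 6$ and run the CDCL solver described below on $OP_n$. Then the sequence of clauses learned by the solver is exactly the following, in this exact order. (Head) $C(1,n-2)$, $C(1,n-3)$. (Descending Cascade) For each $j$ descending from $n-2$ to $2$, the block $C(j,n-2), C(j,n-3),\dots,C(j,j-1)$. (Tail) $C(1,n-4), C(1,n-5),\dots,C(1,2)$. After learning these clauses, the solver derives that $OP_n$ is unsatisfiable.
   Context: Ordering principle: for $n\ge 1$, the variables are $P_{i,j}$ for $1\le i,j\le n$ with $i\ne j$. The formula $OP_n$ is the conjunction of three families of clauses. - Transitivity clauses: $A(i,j,k)=\neg P_{i,j}\lor\neg P_{j,k}\lor P_{i,k}$ for pairwise distinct $i,j,k$. - Antisymmetry clauses: $B(i,j)=\neg P_{i,j}\lor\neg P_{j,i}$ for $i\ne j$. - Non-minimality clauses: $D(j)=\bigvee_{i\ne j}P_{i,j}$ for each $j$. For a column $j$, let $\mathcal{L}_j=\langle P_{1,j},\dots,P_{j-1,j},P_{j+1,j},\dots,P_{n,j}\rangle$ be the variables of column $j$ in increasing row order. $C(j,k)$ denotes the disjunction of the first $k$ variables of $\mathcal{L}_j$ (all positive). CDCL configuration: - Propagation and conflicts: unit propagation; on a conflict, 1UIP clause learning. Learned clauses are kept forever (no deletion). The solver restarts (backtracks to decision level 0) after every conflict. A conflict reached with no decisions yields UNSAT. - Branching: VSIDS. Scores start at $0$, and after the $t$-th conflict $q(x,t)=b(x,t)+\delta q(x,t-1)$, where $b(x,t)=1$ iff $x$ occurs in the clause learned at conflict $t$. The decay factor is $\delta\le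 1/2$. Each decision picks an unassigned variable of highest score. Ties are broken by taking the first such variable in the column-major order $P_{2,1},\dots,P_{n,1},P_{1,2},\dots,P_{n,2},\dots,P_{1,n},\dots,P_{n-1,n}$. - Phase: decided variables are always assigned false.
   Formalization: Unit propagation is taken to process assigned literals first-in-first-out (the order is unspecified in the text and the claim fails for arbitrary order), and the decay factor is taken positive, 0 < δ ≤ 1/2 (the claim fails for δ = 0). *)

(* Defs.v *)
From mathcomp Require Import all_boot all_order all_algebra.
From Stdlib Require Import Relation_Operators.

Set Implicit Arguments.
Unset Strict Implicit.
Unset Printing Implicit Defensive.

Import Order.TTheory GRing.Theory Num.Theory.

(* A literal (x, b) is the variable x if b = true and its negation otherwise.
   Clauses are sets of literals, so they are compared up to order and
   repetition of literals. *)
Definition literal (V : finType) : finType := (V * bool)%type.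
Definition clause (V : finType) : finType := {set literal V}.

Section Solver.

Variable V : finType.

Implicit Types (x y : V) (l : literal V) (C D : clause V) (L : seq (clause V)).

Definition neg l : literal V := (l.1, ~~ l.2).

Definition occurs x C : bool := ((x, true) \in C) || ((x, false) \in C).

(* An entry of the trail: the literal made true, its decision level, and the
   clause that propagated it (None for a decision). *)
Record entry := Entry {
  elit : literal V;
  elevel : nat;
  ereason : option (clause V)
}.

(* Trails are in chronological order. *)
Definition trail := seq entry.

Implicit Types (T P Q : trail) (e : entry).

Definition level T : nat := count (fun e => ~~ ereason e) T.

Definition is_true_lit T l : bool := l \in map elit T.
Definition is_false_lit T l : bool := is_true_lit T (neg l).
Definition unassigned T x : bool := x \notin [seq (elit e).1 | e <- T].

Definition falsified T C : bool := [forall l in C, is_false_lit T l].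

Definition unit_at T C l : bool :=
  [&& l \in C, unassigned T l.1 & falsified T (C :\ l)].

Definition current_lits T C : {set literal V} :=
  [set l in C |
    has (fun e => (elit e == neg l) && (elevel e == level T)) T].

(* 1UIP: following the trail backwards (S is the part still to be visited, most
   recent entry first), resolve the conflict clause with the reasons of its
   literals until only one literal of the current decision level is left.
   Literals falsified at lower levels, including level 0, are kept. *)
Fixpoint resolve_back T (S : seq entry) C : clause V :=
  if #|current_lits T C| <= 1 then C else
  if S is e :: S' then
    if neg (elit e) \in C then
      if ereason e is Some D
      then resolve_back T S' ((C :\ neg (elit e)) :|: (D :\ elit e))
      else C
    else resolve_back T S' C
  else C.

Definition learn T C : clause V := resolve_back T (rev T) C.

Section Scores.

Local Open Scope ring_scope.

(* q(x, t), where L is the sequence of the t clauses learned so far. *)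
Definition vsids (R : realFieldType) (delta : R) L x : R :=
  foldl (fun q C => (occurs x C)%:R + delta * q) 0 L.

(* vars lists the variables of the formula in tie-breaking order. *)
Definition vsids_choice (R : realFieldType) (delta : R) (vars : seq V) L T x :
    bool :=
  [&& x \in vars, unassigned T x &
    all (fun y => unassigned T y ==>
        ((vsids delta L y < vsids delta L x)
         || ((vsids delta L y == vsids delta L x)
             && (index x vars <= index y vars)%N))) vars].

End Scores.

(* Search L P Q: the clauses L have been learned so far, in this order, and the
   trail is P ++ Q; Q is the propagation queue, i.e., the assigned literals
   whose consequences have not been completely drawn yet. *)
Inductive state :=
  | Search of seq (clause V) & trail & trail
  | Sat of seq (clause V)
  | Unsat of seq (clause V).

Variables (R : realFieldType) (delta : R).
Variables (F : {set clause V}) (vars : seq V).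

Definition database L : {set clause V} := F :|: [set C in L].

(* No clause is falsified, or still unit under T, on account of P alone. *)
Definition settled L P T : bool :=
  [forall C in database L,
    ~~ falsified P C && [forall l, unit_at T C l ==> ~~ falsified P (C :\ l)]].

(* Unit propagation processes the trail first in, first out.  Everything else
   is nondeterministic: which unit clause containing the negation of the head
   of the queue is used, whether one whose other literals are not all processed
   is used now or when a later literal is processed (as with watched literals),
   and when a falsified clause is noticed. *)
Inductive cdcl_step : state -> state -> Prop :=
  | PropagateSingleton L P Q l :
      [set l] \in database L -> unassigned (P ++ Q) l.1 ->
      cdcl_step (Search L P Q)
        (Search L P (rcons Q (Entry l (level (P ++ Q)) (Some [set l]))))
  | Propagate L P e Q C l :
      C \in database L -> neg (elit e) \in C -> unit_at (P ++ e :: Q) C l ->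
      cdcl_step (Search L P (e :: Q))
        (Search L P
           (rcons (e :: Q) (Entry l (level (P ++ e :: Q)) (Some C))))
  | Dequeue L P e Q :
      settled L (rcons P e) (P ++ e :: Q) ->
      cdcl_step (Search L P (e :: Q)) (Search L (rcons P e) Q)
  | Decide L P x :
      settled L P P -> vsids_choice delta vars L P x ->
      cdcl_step (Search L P [::])
        (Search L P [:: Entry (x, false) (level P).+1 None])
  | LearnAndRestart L P Q C :
      C \in database L -> falsified (P ++ Q) C -> 0 < level (P ++ Q) ->
      cdcl_step (Search L P Q)
        (Search (rcons L (learn (P ++ Q) C)) [::] [::])
  | DeriveUnsat L P Q C :
      C \in database L -> falsified (P ++ Q) C -> level (P ++ Q) = 0 ->
      cdcl_step (Search L P Q) (Unsat L)
  | DeriveSat L P :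
      settled L P P -> all (fun x => ~~ unassigned P x) vars ->
      cdcl_step (Search L P [::]) (Sat L).

Definition cdcl_init : state := Search [::] [::] [::].

Definition cdcl_reachable (s : state) : Prop :=
  clos_refl_trans_1n state cdcl_step cdcl_init s.

Definition cdcl_halted (s : state) : Prop := forall s', ~ cdcl_step s s'.

(* No run from s is infinite. *)
Definition cdcl_terminates_from (s : state) : Prop :=
  Acc (fun t' t => cdcl_step t t') s.

End Solver.

Section OrderingPrinciple.

Variable n : nat.

(* Indices in 'I_n start at 0: the pair (i, j) stands for P_{i+1, j+1}.  The
   pairs (i, i) are not variables of OP_n: they neither occur in its clauses
   nor belong to op_vars. *)
Definition op_var : finType := ('I_n * 'I_n)%type.

Definition posP (i j : 'I_n) : literal op_var := ((i, j), true).
Definition negP (i j : 'I_n) : literal op_var := ((i, j), false).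

Definition clauseA (i j k : 'I_n) : clause op_var :=
  [set negP i j; negP j k; posP i k].
Definition clauseB (i j : 'I_n) : clause op_var := [set negP i j; negP j i].
Definition clauseD (j : 'I_n) : clause op_var :=
  [set posP i j | i : 'I_n & i != j].

Definition OP : {set clause op_var} :=
  [set C | [exists i, exists j, exists k,
              [&& i != j, j != k, i != k & C == clauseA i j k]]]
  :|: [set C | [exists i, exists j, (i != j) && (C == clauseB i j)]]
  :|: [set clauseD j | j : 'I_n].

(* Column-major order. *)
Definition op_vars : seq op_var :=
  [seq x : op_var <- [seq (i, j) | j <- enum 'I_n, i <- enum 'I_n] | x.1 != x.2].

(* L_j and C(j, k), with j counted from 1. *)
Definition column (j : nat) : seq op_var := [seq x : op_var <- op_vars | (nat_of_ord x.2).+1 == j].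

Definition clauseC (j k : nat) : clause op_var :=
  [set (x, true) | x in take k (column j)].

(* [:: a; a - 1; ...; b] *)
Definition downto (a b : nat) : seq nat := rev (iota b (a.+1 - b)).

Definition head_clauses : seq (clause op_var) :=
  [:: clauseC 1 (n - 2); clauseC 1 (n - 3)].

Definition cascade_clauses : seq (clause op_var) :=
  flatten [seq [seq clauseC j k | k <- downto (n - 2) (j - 1)]
          | j <- downto (n - 2) 2].

Definition tail_clauses : seq (clause op_var) :=
  [seq clauseC 1 k | k <- downto (n - 4) 2].

End OrderingPrinciple.

(* Main.v *)
(* Indices start at 0, N is the last one, and C(j,k) consists of the P_{i,j}
   with i <= k and i <> j. Before a conflict the trail is determined: all rows
   below a bound b of one column are false, possibly together with one true
   variable P_{j,c} and the copy of the falsified rows that it forces in column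
   j, and this partial assignment is closed under unit propagation. At the last
   decision the rows i < m of a column j are all false, C(j,m) yields P_{m,j},
   and P_{m,j} falsifies the rows i < m of column m through A(i,m,j) and B(j,m).
   So C(m,m), which is D(N) if m = N, is falsified, and resolving it with these
   reasons leads to C(j,m-1). When m = N-1 the clause C(m,m) is not known yet;
   then D(m) yields P_{N,m}, and the same argument first runs from column m to
   column N.

   First-in-first-out propagation is what makes the learned clause independent
   of the choices of the solver: all of column m is falsified while P_{m,j} is
   at the head of the queue, hence with the reasons above. What is propagated
   afterwards, as long as the conflict is overlooked, stays within an assignment
   falsifying no clause but C(m,m): a linear order with least element N if m = N,
   and a small explicit partial assignment otherwise.

   As delta <= 1/2, scores compare occurrence times lexicographically, most
   recent first, so decisions exhaust the column of the last learned clauses in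
   increasing row order. *)

Require Import Defs.
From HB Require Import structures.
From mathcomp Require Import all_boot all_order all_algebra zify.

Set Implicit Arguments.
Unset Strict Implicit.
Unset Printing Implicit Defensive.

Import Order.TTheory GRing.Theory Num.Theory.

Ltac arith :=
  repeat match goal with
  | H : context [_ \in _] |- _ => clear H
  | H : context [#|_|] |- _ => clear H
  end; lia.

Section EntryEqType.

Variable V : finType.

Definition tuple_of_entry (e : entry V) := (elit e, elevel e, ereason e).
Definition entry_of_tuple t : entry V := Entry t.1.1 t.1.2 t.2.

Lemma tuple_of_entryK : cancel tuple_of_entry entry_of_tuple.
Proof. by case. Qed.

HB.instance Definition _ := Equality.copy (entry V) (can_type tuple_of_entryK).

End EntryEqType.

(** * Trails and literals *)

Section Trails.

Variable V : finType.
Implicit Types (l : literal V) (C D : clause V) (T X : trail V).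

Lemma negK : involutive (@neg V).
Proof. by case=> x b; rewrite /neg /= negbK. Qed.

Definition tvars T := [seq (elit e).1 | e <- T].

Definition propagated (r : nat) X :=
  all (fun e => (ereason e != None) && (elevel e == r)) X.

Lemma level_cat T X : level (T ++ X) = level T + level X.
Proof. exact: count_cat. Qed.

Lemma level_propagated r X : propagated r X -> level X = 0.
Proof.
elim: X => //= e X IH /andP[/andP[he _] /IH].
by rewrite /level /= => ->; case: (ereason e) he.
Qed.

Lemma resolve_back_stop T X C :
  #|current_lits T C| <= 1 -> resolve_back T X C = C.
Proof. by case: X => [|e X] /= ->. Qed.

Lemma falsifiedP T C :
  reflect (forall l, l \in C -> neg l \in map (@elit V) T) (falsified T C).
Proof.
apply: (iffP forallP) => h l; first by move=> hl; have := h l; rewrite hl.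
by apply/implyP => /h.
Qed.

Lemma falsified_sub T X C :
  {subset map (@elit V) T <= map (@elit V) X} -> falsified T C -> falsified X C.
Proof. by move=> h /falsifiedP hC; apply/falsifiedP => l /hC /h. Qed.

End Trails.

Section NatLiterals.

Variable N : nat.
Local Notation var := (op_var N.+1).
Local Notation lit := (literal (op_var N.+1)).
Local Notation cls := (clause (op_var N.+1)).
Implicit Types (l : lit) (C D : cls) (T X : trail (op_var N.+1)).

Definition nl l : nat * nat * bool := (l.1.1 : nat, l.1.2 : nat, l.2).
Definition mk i y s : lit := ((inord i, inord y), s).
Definition nls T := [seq nl (elit e) | e <- T].

Lemma nl_inj : injective nl.
Proof. by case=> [[i y] s] [[i' y'] s'] [] /val_inj -> /val_inj -> ->. Qed.

Lemma nl_mk i y s : i <= N -> y <= N -> nl (mk i y s) = (i, y, s).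
Proof. by move=> hi hy; rewrite /nl /= !inordK. Qed.

Lemma mk_eq l i y s : nl l = (i, y, s) -> l = mk i y s.
Proof. by case: l => [[i' y'] s'] [<- <- <-]; rewrite /mk !inord_val. Qed.

Lemma mk_eqE i y s i' y' s' :
  i <= N -> y <= N -> i' <= N -> y' <= N ->
  (mk i y s == mk i' y' s') = [&& i == i', y == y' & s == s'].
Proof. by move=> *; rewrite -(inj_eq nl_inj) !nl_mk // !xpair_eqE andbA. Qed.

Lemma nl_le l : ((nl l).1.1 <= N) && ((nl l).1.2 <= N).
Proof. by case: l => [[i y] s]; rewrite /= -ltnS ltn_ord -ltnS ltn_ord. Qed.

Lemma nl_neg l : nl (neg l) = ((nl l).1.1, (nl l).1.2, ~~ (nl l).2).
Proof. by case: l => [[i y] s]. Qed.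

Lemma neg_mk i y s : neg (mk i y s) = mk i y (~~ s).
Proof. by []. Qed.

Lemma mem_nls T l : (nl l \in nls T) = (l \in map (@elit var) T).
Proof. by rewrite /nls map_comp (mem_map nl_inj). Qed.

Lemma nls_cat T X : nls (T ++ X) = nls T ++ nls X.
Proof. exact: map_cat. Qed.

Lemma nls_le T i y s : (i, y, s) \in nls T -> (i <= N) && (y <= N).
Proof. by move=> /mapP[e _ he]; have := nl_le (elit e); rewrite -he. Qed.

Lemma falsified_nls T C :
  falsified T C <-> (forall l, l \in C -> nl (neg l) \in nls T).
Proof.
split; first by move=> /falsifiedP h l /h; rewrite mem_nls.
by move=> h; apply/falsifiedP => l /h; rewrite mem_nls.
Qed.

Lemma unassigned_nl T l s :
  unassigned T l.1 -> (((nl l).1.1, (nl l).1.2, s) \in nls T) = false.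
Proof.
move=> h; apply/negbTE; apply: contra h => /mapP[e he hl]; apply/mapP.
by exists e => //; rewrite (mk_eq (esym hl)) (mk_eq (surjective_pairing (nl l))) /=;
  case: l hl => [[i y] b]; rewrite /mk /= !inord_val.
Qed.

Lemma assigned_nls T l i y s :
  nl l = (i, y, s) -> ~~ unassigned T l.1 ->
  (i, y, true) \in nls T \/ (i, y, false) \in nls T.
Proof.
move=> hl; rewrite negbK => /mapP[e he hv].
have : nl (elit e) \in nls T by apply/mapP; exists e.
move: hl; rewrite /nl hv => -[<- <- _].
by case: (elit e).2; [left|right].
Qed.

Lemma uniq_nls T X i y s s' :
  uniq (tvars (T ++ X)) -> (i, y, s) \in nls T -> (i, y, s') \in nls X -> False.
Proof.
rewrite /tvars map_cat cat_uniq => /and3P[_ /hasPn h _] /mapP[e he hl] /mapP[e' he' hl'].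
have /h /negP : (elit e').1 \in [seq (elit e).1 | e <- X] by apply/mapP; exists e'.
apply; apply/mapP; exists e => //=.
by rewrite (mk_eq (esym hl)) (mk_eq (esym hl')).
Qed.

Definition isA C i y k :=
  forall l, (l \in C) = (nl l \in [:: (i, y, false); (y, k, false); (i, k, true)]).
Definition isB C i y :=
  forall l, (l \in C) = (nl l \in [:: (i, y, false); (y, i, false)]).

(* In zero-based indices, [C(y + 1, k)] is [colC y k] as soon as [y <= k], and
   [D(y + 1)] is [colC y N]. *)
Definition colC y k : cls :=
  [set l : lit | [&& l.2, (l.1.2 : nat) == y, (l.1.1 : nat) != y & l.1.1 <= k]].

Lemma in_colC y k l :
  (l \in colC y k) = [&& (nl l).2, (nl l).1.2 == y, (nl l).1.1 != y & (nl l).1.1 <= k].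
Proof. by rewrite inE. Qed.

Section Descent.

Variables (T : trail (op_var N.+1)) (j m d : nat).
Hypotheses (hjm : j < m) (hmN : m <= N) (hdm : d < m) (hdj : d != j).

Definition is_current l :=
  has (fun e => (elit e == neg l) && (elevel e == level T)) T.

Hypothesis curm : forall i, i < m -> is_current (mk i m true).
Hypothesis curj : is_current (mk m j false).
Hypothesis curd : is_current (mk d j true).

Definition good_lit (t : nat * nat * bool) :=
  [|| [&& t.2, t.1.2 == m & t.1.1 < m],
      [&& t.2, t.1.2 == j, t.1.1 < m & t.1.1 != j]
    | [&& ~~ t.2, t.1.1 == m & t.1.2 == j]].

(* The clauses met while resolving [colC m m] back to [colC j m.-1]. *)
Definition good (G : cls) :=
  [/\ forall l, l \in G -> good_lit (nl l),
      forall i, i < m -> i != j -> (mk i m true \in G) || (mk i j true \in G)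
    & forall i, i < m -> mk i m true \in G ->
        (mk j m true \in G) || (mk m j false \in G)].

Lemma good_done G :
  good G -> (forall i, i < m -> mk i m true \notin G) -> mk m j false \notin G ->
  G = colC j m.-1.
Proof.
move=> [h1 h2 _] h3 h4; apply/setP => l; rewrite in_colC.
have := nl_le l; case E : (nl l) => [[i y] s] /= hle.
have {}E := mk_eq E; rewrite E; apply/idP/idP.
  move=> hl; have := h1 _ hl; rewrite nl_mk /good_lit /=; try lia.
  case/or3P.
  - by case/and3P=> hs /eqP hy hi; move: (h3 _ hi); rewrite -hy -{1}hs hl.
  - lia.
  - by case/and3P=> hs /eqP hi /eqP hy; move: h4; rewrite -hi -hy -(negbTE hs) hl.
case/and4P=> -> /eqP -> hj hk.
have hi : i < m by lia.
by have := h2 i hi hj; rewrite (negbTE (h3 i hi)).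
Qed.

Lemma good_final G :
  good G -> #|current_lits T G| <= 1 -> G = colC j m.-1.
Proof.
move=> hG /card_le1_eqP h1.
have two a b : a \in G -> b \in G -> is_current a -> is_current b -> a = b.
  by move=> ha hb ca cb; apply: h1; rewrite inE ?ha ?hb.
case: (hG) => _ h2 h3.
have [i [y [hcur hin hi hy]]] : exists i y, [/\ is_current (mk i y true),
    mk i y true \in G, i = d & (y == m) || (y == j)].
  by have /orP[hd|hd] := h2 d hdm hdj; [exists d, m|exists d, j];
    split; rewrite ?eqxx ?orbT //; exact: curm.
have h4 : mk m j false \notin G.
  apply/negP => h; have /eqP := two _ _ hin h hcur curj.
  by rewrite mk_eqE; arith.
apply: good_done => // a ha; apply/negP => hma.
have /orP[hjG|] := h3 _ ha hma; last by rewrite (negbTE h4).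
have /eqP := two _ _ hin hjG hcur (curm hjm).
by rewrite mk_eqE; arith.
Qed.

Lemma good_colC : good (colC m m).
Proof.
split=> [l|i hi hij|i hi _].
- by rewrite in_colC /good_lit; case: (nl l) => [[i y] s] /=; lia.
- by rewrite in_colC nl_mk /=; lia.
- by rewrite in_colC nl_mk /=; lia.
Qed.

Lemma resolve_descent T2 e0 S0 :
  nl (elit e0) = (m, j, true) -> ereason e0 = Some (colC j m) ->
  (forall e i, e \in T2 -> i < m -> nl (elit e) = (i, m, false) ->
     exists D, ereason e = Some D /\ (if i == j then isB D j m else isA D i m j)) ->
  (forall i, i < m -> (i, m, false) \in nls T2) ->
  (forall i, i < m -> i != j -> (i, j, false) \notin nls T2) ->
  (m, j, true) \notin nls T2 -> uniq (tvars T2) ->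
  resolve_back T (rev (e0 :: T2) ++ S0) (colC m m)
    = resolve_back T S0 (colC j m.-1).
Proof.
move=> he0 hr0 hr hall hnj hnm.
have E0 := mk_eq he0.
set K := colC j m.-1.
have main : forall X G, good G ->
    (forall e i, e \in X -> i < m -> nl (elit e) = (i, m, false) ->
     exists D, ereason e = Some D /\ (if i == j then isB D j m else isA D i m j)) ->
    (forall i, i < m -> mk i m true \in G -> (i, m, false) \in nls X) ->
    (forall i, i < m -> i != j -> (i, j, false) \notin nls X) ->
    (m, j, true) \notin nls X -> uniq (tvars X) ->
    resolve_back T (rev (e0 :: X) ++ S0) G = resolve_back T S0 K.
  elim/last_ind => [|X e IH] G hG hrX hX hnjX hnmX huX.
    rewrite /rev /=; case: ifP => hc.
      by rewrite /K -(good_final hG hc) resolve_back_stop.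
    have hm i : i < m -> mk i m true \notin G.
      by move=> hi; apply/negP => /(hX _ hi).
    rewrite hr0 E0 neg_mk /=; case: ifP => hin; last first.
      by rewrite (good_done hG hm) ?hin.
    congr resolve_back; apply/setP => l.
    have := nl_le l; case E : (nl l) => [[i y] s] /= hle.
    have {}E := mk_eq E; rewrite E => {l E}.
    case: (hG) => h1 h2 _; have := h1 (mk i y s); have := hm i; have := h2 i.
    have [hiN hyN] := andP hle; have hjN : j <= N by arith.
    rewrite in_setU !in_setD1 !mk_eqE // !in_colC nl_mk // /good_lit /=.
    case: s => /=; last by case: (mk i y false \in G) => /=; arith.
    case: (eqVneq y m) => [->|hy]; first by case: (mk i m true \in G) => /=; arith.
    case: (eqVneq y j) => [->|hy']; first by
      case: (mk i m true \in G); case: (mk i j true \in G) => /=; arith.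
    by case: (mk i y true \in G) => /=; arith.
  rewrite rev_cons rev_rcons rcons_cons cat_cons -rev_cons.
  have huX' : uniq (tvars X) /\ (elit e).1 \notin tvars X.
    by move: huX; rewrite /tvars map_rcons rcons_uniq => /andP[].
  have sub i y s : (i, y, s) \notin nls (rcons X e) -> (i, y, s) \notin nls X.
    by rewrite /nls map_rcons mem_rcons in_cons negb_or => /andP[].
  have IHX G' : good G' ->
      (forall i, i < m -> mk i m true \in G' -> (i, m, false) \in nls X) ->
      resolve_back T (rev (e0 :: X) ++ S0) G' = resolve_back T S0 K.
    move=> hG' hX'; apply: IH => //.
    - by move=> e' i he'; apply: hrX; rewrite mem_rcons in_cons he' orbT.
    - by move=> i hi hij; apply: sub; apply: hnjX.
    - exact: sub.
    - by case: huX'.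
  rewrite /=; case: ifP => hc.
    by rewrite /K -(good_final hG hc) resolve_back_stop.
  case: ifP => hin; last first.
    apply: IHX => // i hi hiG; have := hX _ hi hiG.
    rewrite /nls map_rcons mem_rcons in_cons => /orP[/eqP he|//].
    by move: hin; rewrite (mk_eq (esym he)) neg_mk /= hiG.
  case: (hG) => h1 h2 h3.
  have eX : e \in rcons X e by rewrite mem_rcons mem_head.
  have := h1 _ hin; rewrite nl_neg.
  have := nl_le (elit e); case E : (nl (elit e)) => [[i y] s] /= hle.
  have memX : (i, y, s) \in nls (rcons X e) by rewrite -E; apply: map_f.
  rewrite /good_lit /= negbK => hg.
  have [hi ey es] : [/\ i < m, y = m & s = false].
    move: hg; case: s E memX => /= E memX.
      by case/andP=> /eqP ei /eqP ey; move: hnmX; rewrite -ei -ey memX.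
    case: (eqVneq y m) => [->|_] /=; first by move=> hi; split=> //; arith.
    case: (boolP [&& _, _ & _]) => // /and3P[/eqP ey hi hij] _.
    by move: (hnjX _ hi hij); rewrite -ey memX.
  have [hiN hmN'] := andP hle; have hjN : j <= N by arith.
  subst y s; have Ee := mk_eq E.
  have [D [hD hDi]] := hrX e i eX hi E.
  rewrite hD; apply: IHX.
    split.
    - move=> l; rewrite in_setU !in_setD1 => /orP[/andP[_ /h1]//|/andP[]].
      rewrite Ee; case: eqP => // hne _.
      case: eqP hDi => [eij|hij] ->.
        rewrite !inE => /orP[/eqP /mk_eq|/eqP ->]; first by rewrite -eij => /hne.
        by rewrite /good_lit /=; arith.
      rewrite !inE => /or3P[/eqP /mk_eq /hne //|/eqP ->|/eqP ->];
        rewrite /good_lit /=; arith.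
    - move=> a ha haj; rewrite !in_setU !in_setD1 Ee neg_mk !mk_eqE; try arith.
      have := h2 a ha haj; case: (eqVneq a i) => [eai|hai] /=; last arith.
      move=> _; rewrite eai in haj *; case: eqP hDi => [eij|hij] hDi; first arith.
      by rewrite !hDi !nl_mk ?inE /= ?eqxx ?orbT; arith.
    - move=> a ha _; rewrite !in_setU !in_setD1 Ee neg_mk !mk_eqE; try arith.
      apply/orP; right; apply/orP; right.
      case: eqP hDi => [eij|hij] hDi; rewrite hDi nl_mk ?inE /= ?eqxx ?orbT; arith.
  move=> a ha; rewrite in_setU !in_setD1 Ee neg_mk !mk_eqE; try arith.
  have [->|hai] := eqVneq a i.
    rewrite eqxx /=; case: eqP hDi => [eij|hij] ->; rewrite nl_mk ?inE; try arith.
      by rewrite !xpair_eqE; arith.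
    by rewrite !xpair_eqE; arith.
  case/orP => [/andP[_ hg']|].
    have := hX _ ha hg'; rewrite /nls map_rcons mem_rcons in_cons E.
    by rewrite !xpair_eqE (negbTE hai).
  by case: eqP hDi => [eij|hij] ->; rewrite nl_mk ?inE ?xpair_eqE; arith.
move=> hu; apply: main => //; first exact: good_colC.
by move=> i hi _; apply: hall.
Qed.

End Descent.
End NatLiterals.

(** * Invariants of arbitrary runs *)

Section Runs.

Variable V : finType.
Variables (R : realFieldType) (delta : R) (F : {set clause V}) (vars : seq V).
Implicit Types (l : literal V) (C D : clause V) (P Q T X : trail V) (L : seq (clause V)).

Local Notation step := (cdcl_step delta F vars).
Local Notation db L := (database F L).

Variant search_step L P Q : state V -> Prop :=
  | StepPropagate C l of C \in db L & unit_at (P ++ Q) C l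
      & (exists e Q', Q = e :: Q' /\ neg (elit e) \in C) \/ C = [set l] :
      search_step L P Q (Search L P (rcons Q (Entry l (level (P ++ Q)) (Some C))))
  | StepDequeue e Q' of Q = e :: Q' & settled F L (rcons P e) (P ++ Q) :
      search_step L P Q (Search L (rcons P e) Q')
  | StepDecide x of Q = [::] & settled F L P P & vsids_choice delta vars L P x :
      search_step L P Q (Search L P [:: Entry (x, false) (level P).+1 None])
  | StepLearn C of C \in db L & falsified (P ++ Q) C & 0 < level (P ++ Q) :
      search_step L P Q (Search (rcons L (learn (P ++ Q) C)) [::] [::])
  | StepUnsat C of C \in db L & falsified (P ++ Q) C & level (P ++ Q) = 0 :
      search_step L P Q (Unsat L)
  | StepSat of Q = [::] & settled F L P P & all (fun x => ~~ unassigned P x) vars :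
      search_step L P Q (Sat L).

Lemma unit_at1 T l : unassigned T l.1 -> unit_at T [set l] l.
Proof.
move=> h; rewrite /unit_at set11 h; apply/falsifiedP => l'.
by rewrite !inE andNb.
Qed.

Lemma stepE L P Q s : step (Search L P Q) s -> search_step L P Q s.
Proof.
move=> h; inversion h; subst.
- by apply: StepPropagate => //; [exact: unit_at1|right].
- by apply: StepPropagate => //; left; exists e, Q0.
- exact: StepDequeue.
- exact: StepDecide.
- exact: (@StepLearn _ _ _ C).
- exact: (@StepUnsat _ _ _ C).
- exact: StepSat.
Qed.

Lemma settledP L P T :
  reflect (forall C, C \in db L ->
             ~~ falsified P C /\ (forall l, unit_at T C l -> ~~ falsified P (C :\ l)))
          (settled F L P T).
Proof.
apply: (iffP forallP) => h C; last first.
  apply/implyP => /h[h1 h2]; rewrite h1; apply/forallP => l.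
  by apply/implyP => /h2.
move=> hC; have := h C; rewrite hC /= => /andP[h1 /forallP h2].
by split=> // l hl; have := h2 l; rewrite hl.
Qed.

Record wf L P Q : Prop := Wf {
  wf_uniq : uniq (tvars (P ++ Q));
  wf_level : all (fun e => elevel e <= level (P ++ Q)) (P ++ Q);
  wf_unit : forall C l, C \in db L -> unit_at (P ++ Q) C l ->
    falsified P (C :\ l) -> C = [set l]
}.

Lemma unassigned_sub T X x :
  {subset map (@elit V) T <= map (@elit V) X} -> unassigned X x -> unassigned T x.
Proof.
move=> h; apply: contra => /mapP[e he ->].
have /h /mapP[e' he' E] : elit e \in map (@elit V) T by apply: map_f.
by rewrite E; apply/mapP; exists e'.
Qed.

Lemma unit_at_shrink P T X C l :
  {subset map (@elit V) T <= map (@elit V) X} ->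
  {subset map (@elit V) P <= map (@elit V) T} ->
  unit_at X C l -> falsified P (C :\ l) -> unit_at T C l.
Proof.
move=> h1 h2 /and3P[hl hu _] hP; rewrite /unit_at hl (unassigned_sub h1 hu) /=.
exact: falsified_sub hP.
Qed.

Lemma subset_catl T X : {subset map (@elit V) T <= map (@elit V) (T ++ X)}.
Proof. by move=> l hl; rewrite map_cat mem_cat hl. Qed.

Lemma wf_init L : wf L [::] [::].
Proof.
split=> // C l _ /and3P[hl _ _] /falsifiedP h.
apply/setP => l'; rewrite inE; apply/idP/eqP => [hl'|-> //].
by apply/eqP; apply/negP => /negP hne; have := h l'; rewrite !inE hne hl'; case/(_ isT).
Qed.

Lemma wf_step L P Q s :
  wf L P Q -> step (Search L P Q) s ->
  if s is Search L' P' Q' then wf L' P' Q' else True.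
Proof.
case=> hu hl hw /stepE; case=> //.
- move=> C l hC hunit _; have E := rcons_cat (Entry l (level (P ++ Q)) (Some C)) P Q.
  split; rewrite -?E.
  + rewrite /tvars map_rcons rcons_uniq hu andbT /=.
    by case/and3P: hunit.
  + rewrite -cats1 all_cat level_cat /level /= !addn0 leqnn !andbT.
    exact: hl.
  + rewrite -cats1 => C' l' hC' hu' hP.
    apply: (hw _ _ hC' _ hP); apply: unit_at_shrink hP; [| |exact: hu'];
      exact: subset_catl.
- move=> e Q' E hs; rewrite E in hu hl hs; split; rewrite ?cat_rcons //.
  by move=> C l /(settledP _ _ _ hs)[_ h] /h /negP.
- move=> x E hs hx; rewrite {}E cats0 in hu hl hw *; split; rewrite ?cats1.
  + rewrite /tvars map_rcons rcons_uniq hu andbT /=.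
    by case/and3P: hx.
  + rewrite -cats1 all_cat level_cat /level /= !addn1 leqnn !andbT.
    by apply: sub_all hl => e /leqW.
  + move=> C l hC hu' hP; have [_ h] := settledP _ _ _ hs _ hC.
    have /h /negP : unit_at P C l.
      by apply: unit_at_shrink hP; [| |exact: hu'] => //; rewrite -cats1; apply: subset_catl.
    by [].
- by move=> *; apply: wf_init.
Qed.

Lemma vsids_choice_exists L T :
  ~~ all (fun x => ~~ unassigned T x) vars -> exists x, vsids_choice delta vars L T x.
Proof.
pose q := vsids delta L.
pose le x y := (q y < q x)%R || ((q y == q x) && (index x vars <= index y vars)).
have le_refl x : le x x by rewrite /le eqxx leqnn orbT.
have le_total x y : le x y || le y x.
  by rewrite /le; case: (ltgtP (q x) (q y)) => //= _; rewrite leq_total.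
have le_trans y x z : le x y -> le y z -> le x z.
  rewrite /le => /orP[h1|/andP[/eqP E1 h1]] /orP[h2|/andP[/eqP E2 h2]].
  - by rewrite (lt_trans h2 h1).
  - by rewrite E2 h1.
  - by rewrite -E1 h2.
  - by rewrite E2 E1 eqxx (leq_trans h1 h2) orbT.
rewrite -has_predC => /hasP[x0 hx0 /negPn hu0].
have main s : x0 \in s -> {subset s <= vars} -> exists x,
    [/\ x \in s, unassigned T x & all (fun y => unassigned T y ==> le x y) s].
  elim: s x0 {hx0} hu0 => // a s IH x0 hu0 hx0 hs.
  have hs' : {subset s <= vars} by move=> y hy; apply: hs; rewrite in_cons hy orbT.
  case: (boolP (has (unassigned T) s)) => [/hasP[x1 hx1 hu1]|hno].
    have [x [hx hux hax]] := IH x1 hu1 hx1 hs'.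
    case: (boolP (unassigned T a)) => hua; last first.
      by exists x; rewrite in_cons hx orbT /= (negbTE hua).
    case/orP: (le_total x a) => hxa.
      by exists x; rewrite in_cons hx orbT /= hxa implybT.
    exists a; rewrite in_cons eqxx /= le_refl implybT; split=> //.
    by apply: sub_all hax => y /implyP h; apply/implyP => /h; apply: le_trans.
  move: hx0; rewrite in_cons => /orP[/eqP E|hx0].
    rewrite E in hu0; exists a; rewrite in_cons eqxx /= le_refl implybT; split=> //.
    apply/allP => y hy; apply/implyP => huy.
    by case/negP: hno; apply/hasP; exists y.
  by case/negP: hno; apply/hasP; exists x0.
have [x [hx hux hax]] := main vars hx0 (fun x h => h).
by exists x; rewrite /vsids_choice hx hux.
Qed.

Lemma progress L P Q : wf L P Q -> exists s, step (Search L P Q) s.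
Proof.
case=> _ _ hw.
case: (boolP [exists C in db L, falsified (P ++ Q) C]) => [/existsP[C /andP[hC hf]]|hno].
  case: (posnP (level (P ++ Q))) => h0.
    by exists (Unsat L); exact: DeriveUnsat hC hf h0.
  by exists (Search (rcons L (learn (P ++ Q) C)) [::] [::]); exact: LearnAndRestart.
have nof C : C \in db L -> ~~ falsified (P ++ Q) C.
  by move=> hC; apply: contra hno => hf; apply/existsP; exists C; rewrite hC.
have unsettled P' : {subset map (@elit V) P' <= map (@elit V) (P ++ Q)} ->
    ~~ settled F L P' (P ++ Q) -> exists C l,
    [/\ C \in db L, unit_at (P ++ Q) C l & falsified P' (C :\ l)].
  move=> hsub /forallPn[C]; rewrite negb_imply => /andP[hC].
  rewrite negb_and negbK => /orP[hf|/forallPn[l]].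
    by have := falsified_sub hsub hf; rewrite (negbTE (nof _ hC)).
  by rewrite negb_imply negbK => /andP[h1 h2]; exists C, l.
have single C l : C \in db L -> unit_at (P ++ Q) C l -> falsified P (C :\ l) ->
    exists s, step (Search L P Q) s.
  move=> hC hu hf; have E := hw _ _ hC hu hf; rewrite E in hC.
  by case/and3P: hu => _ hu _; eexists; exact: PropagateSingleton hC hu.
case: Q => [|e Q] in hw hno nof unsettled single *.
  rewrite cats0 in unsettled.
  case: (boolP (settled F L P P)) => hs; last first.
    have [C [l [hC hu hf]]] := unsettled P (fun _ h => h) hs.
    by apply: (single C l hC) => //; rewrite cats0.
  case: (boolP (all (fun x => ~~ unassigned P x) vars)) => ha.
    by exists (Sat L); exact: DeriveSat.
  have [x hx] := vsids_choice_exists L ha.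
  by eexists; exact: Decide hs hx.
case: (boolP (settled F L (rcons P e) (P ++ e :: Q))) => hs.
  by eexists; exact: Dequeue hs.
have [|C [l [hC hu hf]]] := unsettled _ _ hs.
  by rewrite -cat_rcons; exact: subset_catl.
case: (boolP (neg (elit e) \in C)) => he.
  by eexists; exact: Propagate hC he hu.
apply: (single C l hC hu); apply/falsifiedP => l' hl'.
have := (falsifiedP _ _ hf) l' hl'; rewrite map_rcons mem_rcons in_cons => /orP[/eqP E|//].
by case/negP: he; rewrite -E negK; move: hl'; rewrite !inE => /andP[].
Qed.

(* Bounds the number of steps until the next conflict. *)
Definition fuel P Q := 2 * (#|V| - size (P ++ Q)) + size Q.

Lemma size_trail L P Q : wf L P Q -> size (P ++ Q) <= #|V|.
Proof.
case=> /card_uniqP hu _ _; rewrite -(size_map (fun e => (elit e).1)) -hu.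
exact: max_card.
Qed.

Lemma fuel_step L P Q P' Q' :
  wf L P Q -> step (Search L P Q) (Search L P' Q') -> fuel P' Q' < fuel P Q.
Proof.
move=> hwf h; have := wf_step hwf h => /= /size_trail; have := size_trail hwf.
rewrite /fuel !size_cat; inversion h; subst => /=; rewrite ?size_rcons /=; try lia.
match goal with H : _ = L |- _ => have := congr1 size H end.
by rewrite size_rcons; lia.
Qed.

End Runs.

(** * Conflicts *)

Section Conflicts.

Variable N : nat.
Local Notation var := (op_var N.+1).
Local Notation lit := (literal (op_var N.+1)).
Local Notation cls := (clause (op_var N.+1)).
Implicit Types (l : lit) (C D : cls) (P Q T X : trail (op_var N.+1)).

Variables (F : {set cls}) (L : seq cls) (KD : nat -> nat -> bool).
Local Notation db := (database F L).

(* [KD y k] says that [colC y k], which may be a clause [D], is in the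
   database. *)
Record db_spec : Prop := DbSpec {
  dbE : forall C, C \in db ->
    [\/ exists i y k, isA C i y k /\
          [&& i <= N, y <= N, k <= N, i != y, y != k & i != k],
        exists i y, isB C i y /\ [&& i <= N, y <= N & i != y]
      | exists y k, C = colC N y k /\ KD y k];
  dbA : forall i y k, [&& i <= N, y <= N, k <= N, i != y, y != k & i != k] ->
    exists2 C, C \in db & isA C i y k;
  dbB : forall i y, [&& i <= N, y <= N & i != y] -> exists2 C, C \in db & isB C i y;
  dbC : forall y k, KD y k -> colC N y k \in db;
  dbK : forall y k, KD y k -> y <= k <= N
}.

Hypothesis hdb : db_spec.

Variant unit_cases T C : nat * nat * bool -> Prop :=
  | UnitA1 i y k of isA C i y k & [&& i <= N, y <= N, k <= N, i != y, y != k & i != k]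
      & (y, k, true) \in nls T & (i, k, false) \in nls T : unit_cases T C (i, y, false)
  | UnitA2 i y k of isA C i y k & [&& i <= N, y <= N, k <= N, i != y, y != k & i != k]
      & (i, y, true) \in nls T & (i, k, false) \in nls T : unit_cases T C (y, k, false)
  | UnitA3 i y k of isA C i y k & [&& i <= N, y <= N, k <= N, i != y, y != k & i != k]
      & (i, y, true) \in nls T & (y, k, true) \in nls T : unit_cases T C (i, k, true)
  | UnitB i y of isB C i y & [&& i <= N, y <= N & i != y]
      & (y, i, true) \in nls T : unit_cases T C (i, y, false)
  | UnitC i y k of KD y k & C = colC N y k & (i <= k) && (i != y)
      & (forall a, a <= k -> a != y -> a != i -> (a, y, false) \in nls T) :
      unit_cases T C (i, y, true).

Lemma unit_nls T C l :
  unit_at T C l -> forall i y s, i <= N -> y <= N ->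
  mk N i y s \in C -> (i, y, s) != nl l -> (i, y, ~~ s) \in nls T.
Proof.
case/and3P=> hl hu /falsified_nls h i y s hi hy hC hne.
have := h (mk N i y s); rewrite !inE hC andbT nl_neg !nl_mk //=; apply.
by apply: contra hne => /eqP <-; rewrite nl_mk.
Qed.

Lemma isB_sym C i y : isB C i y -> isB C y i.
Proof. by move=> h l; rewrite h !inE orbC. Qed.

Lemma unit_casesP T C l : C \in db -> unit_at T C l -> unit_cases T C (nl l).
Proof.
move=> hC hu; have hn := unit_nls hu; case/and3P: hu => hl _ _.
case: (dbE hdb hC) => [[i [y [k [hA hd]]]]|[i [y [hB hd]]]|[y [k [E hK]]]].
- have m1 : mk N i y false \in C by rewrite hA nl_mk ?inE ?eqxx //; arith.
  have m2 : mk N y k false \in C by rewrite hA nl_mk ?inE ?eqxx ?orbT //; arith.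
  have m3 : mk N i k true \in C by rewrite hA nl_mk ?inE ?eqxx ?orbT //; arith.
  have n1 := hn _ _ _ _ _ m1; have n2 := hn _ _ _ _ _ m2; have n3 := hn _ _ _ _ _ m3.
  move: hl; rewrite hA !inE => /or3P[] /eqP E; rewrite E in n1 n2 n3 *.
  + by apply: (UnitA1 hA hd); [apply: n2|apply: n3]; rewrite ?xpair_eqE; arith.
  + by apply: (UnitA2 hA hd); [apply: n1|apply: n3]; rewrite ?xpair_eqE; arith.
  + by apply: (UnitA3 hA hd); [apply: n1|apply: n2]; rewrite ?xpair_eqE; arith.
- have m1 : mk N i y false \in C by rewrite hB nl_mk ?inE ?eqxx //; arith.
  have m2 : mk N y i false \in C by rewrite hB nl_mk ?inE ?eqxx ?orbT //; arith.
  have n1 := hn _ _ _ _ _ m1; have n2 := hn _ _ _ _ _ m2.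
  move: hl; rewrite hB !inE => /orP[] /eqP E; rewrite E in n1 n2 *.
  + by apply: (UnitB hB hd); apply: n2; rewrite ?xpair_eqE; arith.
  + apply: (UnitB (isB_sym hB)); first arith.
    by apply: n1; rewrite ?xpair_eqE; arith.
- have := dbK hdb hK; have : l \in colC N y k by rewrite -E.
  rewrite in_colC; case El : (nl l) => [[i y'] s] /= /and4P[hs /eqP hy hi hk] hle.
  rewrite hs hy in El *; apply: (UnitC hK E); first by rewrite hk.
  move=> a ha hay hai; apply: (hn _ _ true); rewrite ?El ?xpair_eqE; try arith.
  by rewrite E in_colC nl_mk /=; arith.
Qed.

Variant falsified_cases T C : Prop :=
  | FalsifiedA i y k of isA C i y k
      & [&& i <= N, y <= N, k <= N, i != y, y != k & i != k]
      & (i, y, true) \in nls T & (y, k, true) \in nls T & (i, k, false) \in nls T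
  | FalsifiedB i y of isB C i y & [&& i <= N, y <= N & i != y]
      & (i, y, true) \in nls T & (y, i, true) \in nls T
  | FalsifiedC y k of KD y k & C = colC N y k
      & (forall a, a <= k -> a != y -> (a, y, false) \in nls T).

Lemma falsified_casesP T C : C \in db -> falsified T C -> falsified_cases T C.
Proof.
move=> hC /falsified_nls hf.
have hn i y s : i <= N -> y <= N -> mk N i y s \in C -> (i, y, ~~ s) \in nls T.
  by move=> hi hy /hf; rewrite nl_neg nl_mk.
case: (dbE hdb hC) => [[i [y [k [hA hd]]]]|[i [y [hB hd]]]|[y [k [E hK]]]].
- apply: (FalsifiedA hA hd); [apply: (hn _ _ false)|apply: (hn _ _ false)|apply: (hn _ _ true)];
    try arith; by rewrite hA nl_mk ?inE ?eqxx ?orbT //; arith.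
- apply: (FalsifiedB hB hd); apply: (hn _ _ false);
    try arith; by rewrite hB nl_mk ?inE ?eqxx ?orbT //; arith.
- have := dbK hdb hK => hle; apply: (FalsifiedC hK E) => a ha hay.
  by apply: (hn _ _ true); rewrite ?E ?in_colC ?nl_mk /=; arith.
Qed.

Lemma subset_nls P T :
  {subset nls P <= nls T} -> {subset map (@elit var) P <= map (@elit var) T}.
Proof. by move=> h l; rewrite -!mem_nls => /h. Qed.

Lemma forced P T C i y s :
  settled F L P T -> {subset nls P <= nls T} -> C \in db ->
  i <= N -> y <= N -> mk N i y s \in C ->
  (forall l, l \in C -> nl l != (i, y, s) -> nl (neg l) \in nls P) ->
  (i, y, true) \in nls T \/ (i, y, false) \in nls T.
Proof.
move=> hs hsub hC hi hy hin hP.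
apply: (@assigned_nls N T (mk N i y s) i y s); first by rewrite nl_mk.
apply/negP => hu; have [_ h] := settledP _ _ _ _ hs _ hC.
have hf : falsified P (C :\ mk N i y s).
  apply/falsified_nls => l; rewrite !inE => /andP[hne hl]; apply: hP => //.
  by apply: contra hne => /eqP /mk_eq ->.
have /h /negP : unit_at T C (mk N i y s).
  by rewrite /unit_at hin hu /=; apply: falsified_sub hf; apply: subset_nls.
by [].
Qed.

Lemma forcedA P T i y k :
  settled F L P T -> {subset nls P <= nls T} ->
  (y, k, true) \in nls P -> (i, k, false) \in nls P ->
  i != y -> y != k -> i != k ->
  (i, y, true) \in nls T \/ (i, y, false) \in nls T.
Proof.
move=> hs hsub h1 h2 d1 d2 d3; have b1 := nls_le h1; have b2 := nls_le h2.
have [|C hC hA] := @dbA hdb i y k; first arith.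
apply: (forced (s := false) hs hsub hC); rewrite ?hA ?nl_mk ?inE ?eqxx //; try arith.
move=> l; rewrite hA !inE nl_neg => /or3P[] /eqP -> //=.
by rewrite eqxx.
Qed.

Lemma forcedB P T i y :
  settled F L P T -> {subset nls P <= nls T} ->
  (y, i, true) \in nls P -> i != y ->
  (i, y, true) \in nls T \/ (i, y, false) \in nls T.
Proof.
move=> hs hsub h1 d1; have b1 := nls_le h1.
have [|C hC hB] := @dbB hdb i y; first arith.
apply: (forced (s := false) hs hsub hC); rewrite ?hB ?nl_mk ?inE ?eqxx //; try arith.
by move=> l; rewrite hB !inE nl_neg => /orP[] /eqP -> //=; rewrite eqxx.
Qed.

Lemma forcedC P T i y k :
  settled F L P T -> {subset nls P <= nls T} -> KD y k -> i <= k -> i != y ->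
  (forall a, a <= k -> a != y -> a != i -> (a, y, false) \in nls P) ->
  (i, y, true) \in nls T \/ (i, y, false) \in nls T.
Proof.
move=> hs hsub hK hi hy h; have b1 := dbK hdb hK.
apply: (forced (s := true) hs hsub (dbC hdb hK)); try arith.
  by rewrite in_colC nl_mk /=; arith.
move=> l; rewrite in_colC nl_neg; case: (nl l) => [[a b] s] /= /and4P[-> /eqP -> ha hk].
by rewrite !xpair_eqE !eqxx !andbT => hai; apply: h.
Qed.

Definition sub_asg T (aT aF : nat -> nat -> bool) :=
  (forall i y, (i, y, true) \in nls T -> aT i y) /\
  (forall i y, (i, y, false) \in nls T -> aF i y).

Definition eq_asg T (aT aF : nat -> nat -> bool) :=
  (forall i y, ((i, y, true) \in nls T) = aT i y) /\
  (forall i y, ((i, y, false) \in nls T) = aF i y).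

Lemma sub_asg_rcons T e aT aF :
  sub_asg T aT aF ->
  (forall i y, nl (elit e) = (i, y, true) -> aT i y) ->
  (forall i y, nl (elit e) = (i, y, false) -> aF i y) -> sub_asg (rcons T e) aT aF.
Proof.
by move=> [h1 h2] h3 h4; split=> i y; rewrite /nls map_rcons mem_rcons in_cons;
  case/orP => [/eqP E|]; auto.
Qed.

Section Descending.

Variables (g f : bool) (j c m : nat).

(* The assignment before [P_{m,j}] is propagated: rows below [b] of column [j]
   are false and, if [g], [P_{j,c}] is true; [f] records that the falsity of
   column [j] is inherited from decisions in column [c]. *)
Definition asgT i y := [&& g, i == j & y == c].
Definition asgF b i y :=
  [|| [&& y == j, i < b & i != j], [&& g, i == c & y == j]
    | [&& f, y == c, i < b, i != j & i != c]].

Definition confT i y := [|| asgT i y, (i == m) && (y == j) | [&& g, i == m & y == c]].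
Definition confF i y := asgF m i y || (y == m) && (i < m).

Record config : Prop := Config {
  cf_jm : j < m <= N;
  cf_m : 2 <= m;
  cf_c : g -> (c < m) && (c != j);
  cf_f : f -> g;
  cf_low : forall k, KD j k -> m <= k;
  cf_pivot : KD j m;
  cf_shadow : forall k, g -> KD c k -> j <= k;
  cf_other : forall y k, KD y k -> y != j -> (g -> y != c) -> 2 <= k
}.

Hypothesis hcf : config.

Lemma not_singleton T C l :
  C \in db -> unit_at T C l -> (g -> (j, c, true) \in nls T) -> C <> [set l].
Proof.
move=> hC hu hgT E; have [hjm hmN] := andP (cf_jm hcf).
have single i y s i' y' s' : i <= N -> y <= N -> i' <= N -> y' <= N ->
    mk N i y s \in C -> mk N i' y' s' \in C -> [&& i == i', y == y' & s == s'].
  move=> b1 b2 b3 b4; rewrite E !inE => /eqP <- /eqP /esym/eqP.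
  by rewrite mk_eqE.
case/and3P: (hu) => _ hun _; have := unassigned_nl true hun.
case: (unit_casesP hC hu) => [i y k hA hd _ _|i y k hA hd _ _|i y k hA hd _ _|i y hB hd _|i y k hK EC hi _].
- by move=> _; have := single i y false i k true; rewrite !hA !nl_mk ?inE ?eqxx ?orbT; arith.
- by move=> _; have := single i y false i k true; rewrite !hA !nl_mk ?inE ?eqxx ?orbT; arith.
- by move=> _; have := single i y false i k true; rewrite !hA !nl_mk ?inE ?eqxx ?orbT; arith.
- by move=> _; have := single i y false y i false; rewrite !hB !nl_mk ?inE ?eqxx ?orbT; arith.
have hle := dbK hdb hK; have h2m := cf_m hcf.
have rows a b : a <= k -> b <= k -> a != y -> b != y -> a = b.
  move=> ha hb hay hby; have := single a y true b y true.
  by rewrite EC !in_colC !nl_mk /=; arith.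
have [ey|hyj] := eqVneq y j.
  subst y; have := cf_low hcf hK; have := rows 0 m; have := rows 1 m; arith.
have [ey|hyc] := boolP (g && (y == c)).
  have [hg /eqP ey'] := andP ey; subst y; have := cf_shadow hcf hg hK => hjk.
  have := cf_c hcf hg => hc; have -> /= : i = j by apply: rows; arith.
  by rewrite hgT.
have : 2 <= k by apply: (cf_other hcf hK hyj) => hg; move: hyc; rewrite hg.
by have := rows 0 1; have := rows 0 2; have := rows 1 2; arith.
Qed.

Definition base T1 tgt K :=
  forall X, propagated (level T1) X -> uniq (tvars (T1 ++ X)) ->
    resolve_back (T1 ++ X) (rev T1) K = tgt.

Definition descent_tail T2 :=
  if T2 is e0 :: T2' then
    [/\ nl (elit e0) = (m, j, true), ereason e0 = Some (colC N j m)
      & forall e i, e \in T2' -> i < m -> nl (elit e) = (i, m, false) ->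
        exists D, ereason e = Some D /\ (if i == j then isB D j m else isA D i m j)]
  else True.

Record descent tgt T1 T2 : Prop := Descent {
  ds_eq : eq_asg T1 asgT (asgF m);
  ds_base : base T1 tgt (colC N j m.-1);
  ds_cur : exists d e, [/\ (d < m) && (d != j), e \in T1, nl (elit e) = (d, j, false)
                         & elevel e = level T1];
  ds_level : 0 < level T1;
  ds_prop : propagated (level T1) T2;
  ds_uniq : uniq (tvars (T1 ++ T2));
  ds_tail : descent_tail T2
}.

Lemma descent_new tgt T1 T2 i : descent tgt T1 T2 -> i < m -> (i, m, false) \notin nls T1.
Proof.
move=> hD hi; have [_ ->] := ds_eq hD; have := cf_jm hcf; have := cf_c hcf.
have := cf_f hcf; rewrite /asgF; arith.
Qed.

Lemma descent_new0 tgt T1 T2 : descent tgt T1 T2 -> (m, j, true) \notin nls T1.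
Proof.
move=> hD; have [-> _] := ds_eq hD; have := cf_jm hcf; have := cf_c hcf.
rewrite /asgT; arith.
Qed.

Lemma descent_base tgt T1 T2 :
  descent tgt T1 T2 -> (forall i, i < m -> (i, m, false) \in nls (T1 ++ T2)) ->
  base (T1 ++ T2) tgt (colC N m m).
Proof.
move=> hD hall X; have [hjm hmN] := andP (cf_jm hcf).
have hall2 i : i < m -> (i, m, false) \in nls T2.
  move=> hi; have := hall i hi; rewrite nls_cat mem_cat.
  by rewrite (negbTE (descent_new hD hi)).
have hl : level (T1 ++ T2) = level T1.
  by rewrite level_cat (level_propagated (ds_prop hD)) addn0.
rewrite hl => hX; rewrite -catA => hu.
have hTX : propagated (level T1) (T2 ++ X).
  by rewrite /propagated all_cat -/(propagated _ T2) (ds_prop hD).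
have hlT : level (T1 ++ T2 ++ X) = level T1.
  by rewrite level_cat (level_propagated hTX) addn0.
rewrite -(ds_base hD hTX hu) rev_cat.
have [d [ed [hd hed hnd hld]]] := ds_cur hD.
have := ds_tail hD; have := ds_uniq hD; case: T2 => [|e0 T2'] in hD hall hall2 hl hTX hlT hu *.
  by have := hall2 0; rewrite in_nil; arith.
move=> huT [hn0 hr0 hr].
have hall3 i : i < m -> (i, m, false) \in nls T2'.
  move=> hi; have := hall2 i hi; rewrite in_cons hn0 => /orP[/eqP|//].
  by case; arith.
have cur i y s e : e \in T1 ++ (e0 :: T2') ++ X -> i <= N -> y <= N ->
   nl (elit e) = (i, y, ~~ s) -> elevel e = level T1 ->
   is_current (T1 ++ (e0 :: T2') ++ X) (mk N i y s).
  move=> he hi hy hn hle; apply/hasP; exists e => //.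
  by rewrite hle hlT eqxx andbT (mk_eq hn) neg_mk.
have lev e : e \in e0 :: T2' -> elevel e = level T1.
  by move=> he; have /allP /(_ e he) /andP[_ /eqP] := ds_prop hD.
apply: (@resolve_descent N _ j m d) => //; try arith.
- move=> i hi; have /mapP[e he hne] := hall3 i hi.
  apply: (cur _ _ _ e); rewrite ?mem_cat ?in_cons ?he ?orbT //; try arith.
  by apply: lev; rewrite in_cons he orbT.
- apply: (cur _ _ _ e0); rewrite ?mem_cat ?in_cons ?eqxx ?orbT //; try arith.
  by apply: lev; rewrite mem_head.
- by apply: (cur _ _ _ ed); rewrite ?mem_cat ?hed //; arith.
- move=> i hi hij; apply/negP => hin.
  have : (i, j, false) \in nls T1.
    by have [_ ->] := ds_eq hD; rewrite /asgF eqxx hi hij.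
  by move=> h; apply: (uniq_nls (s' := false) huT h); rewrite in_cons hin orbT.
- apply/negP => hin; move: huT; rewrite /tvars map_cat cat_uniq /= => /and4P[_ _ /negP h _].
  apply: h; case/mapP: hin => e he hne; apply/mapP; exists e => //.
  by rewrite (mk_eq hn0) (mk_eq (esym hne)).
- by move: huT; rewrite /tvars map_cat cat_uniq /= => /and4P[].
Qed.

Lemma descent_learn tgt T1 T2 :
  descent tgt T1 T2 -> falsified (T1 ++ T2) (colC N m m) ->
  learn (T1 ++ T2) (colC N m m) = tgt /\ 0 < level (T1 ++ T2).
Proof.
move=> hD /falsified_nls hf; have [hjm hmN] := andP (cf_jm hcf); split; last first.
  by rewrite level_cat (leq_trans (ds_level hD)) ?leq_addr.
have hb := descent_base hD; have := hb _ [::]; rewrite cats0; apply=> //; last exact: ds_uniq hD.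
move=> i hi; have := hf (mk N i m true); rewrite nl_neg nl_mk; try arith.
by apply; rewrite in_colC nl_mk /=; arith.
Qed.

(* The head of the queue is a negative literal of column [j]. *)
Definition stage1 tgt P Q := exists T1 T2,
  [/\ descent tgt T1 T2, P ++ Q = T1 ++ T2, size P < size T1,
      (forall e, e \in drop (size P) T1 -> exists i, i < m /\ nl (elit e) = (i, j, false))
    & forall e, e \in T2 -> nl (elit e) = (m, j, true) \/
                            exists i, i < m /\ nl (elit e) = (i, m, false)].

Definition after_pivot T := forall e, e \in T ->
  (exists i, i < m /\ nl (elit e) = (i, m, false)) \/ g /\ nl (elit e) = (m, c, true).

(* The head of the queue is [P_{m,j}]. *)
Definition stage2 tgt P Q := exists e0 T2,
  [/\ descent tgt P (e0 :: T2), Q = e0 :: T2 & after_pivot T2].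

(* [colC m m] is falsified, but this may remain unnoticed for a while. *)
Definition stage3 wT wF tgt P Q := exists T1 e0 X1 X2 Y,
  [/\ descent tgt T1 (e0 :: X1 ++ X2 ++ Y), P = T1 ++ e0 :: X1,
      Q = X2 ++ Y /\ X2 != [::],
      after_pivot (X1 ++ X2) /\ (forall i, i < m -> (i, m, false) \in nls (X1 ++ X2))
    & sub_asg Y wT wF].

Record final (wT wF : nat -> nat -> bool) : Prop := Final {
  fn_subT : forall i y, confT i y -> wT i y;
  fn_subF : forall i y, confF i y -> wF i y;
  fn_col : KD m m;
  fn_falsified : forall T C, sub_asg T wT wF -> C \in db -> falsified T C -> C = colC N m m;
  fn_unit : forall T C l, sub_asg T wT wF -> (forall i, i < m -> (i, m, false) \in nls T) ->
    C \in db -> unit_at T C l ->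
    (exists h, neg h \in C /\ ((exists i, i < m /\ nl h = (i, m, false)) \/
                               g /\ nl h = (m, c, true))) ->
    if (nl l).2 then wT (nl l).1.1 (nl l).1.2 else wF (nl l).1.1 (nl l).1.2
}.

Lemma descent_sub tgt T1 T2 : descent tgt T1 T2 ->
  (forall e, e \in T2 -> nl (elit e) = (m, j, true) \/
     (exists i, i < m /\ nl (elit e) = (i, m, false)) \/ g /\ nl (elit e) = (m, c, true)) ->
  sub_asg (T1 ++ T2) confT confF.
Proof.
move=> hD h; have [e1 e2] := ds_eq hD.
split=> i y; rewrite nls_cat mem_cat /confT /confF => /orP[].
- by rewrite e1 => ->.
- case/mapP=> e /h h' E; move: h'; rewrite -E => -[[-> ->]|[[a [_ //]]|[-> [-> ->]]]];
    by rewrite !eqxx ?orbT.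
- by rewrite e2 => ->.
- by case/mapP=> e /h h' E; move: h'; rewrite -E => -[//|[[a [ha [-> ->]]]|[_ //]]];
    rewrite eqxx ha orbT.
Qed.

Lemma descent_rcons tgt T1 T2 e :
  descent tgt T1 T2 -> ereason e != None -> elevel e = level T1 ->
  uniq (tvars (T1 ++ rcons T2 e)) -> descent_tail (rcons T2 e) ->
  descent tgt T1 (rcons T2 e).
Proof.
case=> h1 h2 h3 h4 h5 _ _ hr hl hu ht; split=> //.
by rewrite /propagated -cats1 all_cat -/(propagated _ T2) h5 /= hr hl eqxx.
Qed.

Lemma descent_uniq tgt T1 T2 l r R0 :
  descent tgt T1 T2 -> unassigned (T1 ++ T2) l.1 ->
  uniq (tvars (T1 ++ rcons T2 (Entry l r R0))).
Proof. by move=> hD hu; rewrite -rcons_cat /tvars map_rcons rcons_uniq (ds_uniq hD) andbT. Qed.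

Lemma descent_lev tgt T1 T2 : descent tgt T1 T2 -> level (T1 ++ T2) = level T1.
Proof. by move=> hD; rewrite level_cat (level_propagated (ds_prop hD)) addn0. Qed.

Lemma stage1_grow tgt P Q C l :
  stage1 tgt P Q -> C \in db -> unit_at (P ++ Q) C l ->
  (exists e Q', Q = e :: Q' /\ neg (elit e) \in C) \/ C = [set l] ->
  stage1 tgt P (rcons Q (Entry l (level (P ++ Q)) (Some C))).
Proof.
move=> [T1 [T2 [hD E hsz hcol hT2]]] hC hu hhd.
have [hjm hmN] := andP (cf_jm hcf); have hc := cf_c hcf; have hf := cf_f hcf.
have hQ : Q = drop (size P) T1 ++ T2.
  have := congr1 (drop (size P)) E; rewrite drop_size_cat // drop_cat hsz.
  by [].
have [e1 e2] := ds_eq hD.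
case: hhd => [[e [Q' [EQ he]]]|hsing]; last first.
  exfalso; apply: not_singleton hC hu _ hsing => hg.
  by rewrite E nls_cat mem_cat e1 /asgT hg !eqxx.
have hedrop : e \in drop (size P) T1.
  have : size (drop (size P) T1) > 0 by rewrite size_drop subn_gt0.
  by move: hQ; rewrite EQ; case: (drop _ _) => //= a s [<- _] _; rewrite mem_head.
have [a [ham hea]] := hcol _ hedrop.
have haT1 : (a, j, false) \in nls T1.
  by rewrite -hea; apply: map_f; apply: mem_drop hedrop.
have haj : a != j by move: haT1; rewrite e2 /asgF; arith.
have [subT subF] : sub_asg (T1 ++ T2) confT confF.
  by apply: descent_sub hD _ => e' /hT2[|]; [left|right; left].
rewrite E in hu *.
have T2ne : (m, j, true) \in nls (T1 ++ T2) -> exists e0 T2', T2 = e0 :: T2'.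
  rewrite nls_cat mem_cat (negbTE (descent_new0 hD)) /=.
  by case: (T2) => // e0 T2' _; exists e0, T2'.
have hneg : nl (neg (elit e)) = (a, j, true) by rewrite nl_neg hea.
have hun := proj1 (andP (proj2 (andP hu))).
have [un1 un2] := (unassigned_nl true hun, unassigned_nl false hun).
exists T1, (rcons T2 (Entry l (level (T1 ++ T2)) (Some C))).
have claim : (nl l = (m, j, true) /\ C = colC N j m /\ T2 = [::]) \/
    (exists e0 T2', T2 = e0 :: T2') /\ nl l = (a, m, false) /\ isA C a m j.
  move: (unit_casesP hC hu) un1 un2; case E' : _ / => [i y k hA hd h1 h2|i y k hA hd h1 h2|i y k hA hd h1 h2|i y hB hd h1|i y k hK EC hi h1] /=;
    rewrite ?E' /= => un1 un2.
  - move: he; rewrite hA hneg !inE => /or3P[/eqP //|/eqP //|/eqP [eia ekj]].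
    subst a k; have ym : y = m by have := subT _ _ h1; rewrite /confT /asgT; arith.
    by subst y; right; split; [apply: T2ne|].
  - move: he; rewrite hA hneg !inE => /or3P[/eqP //|/eqP //|/eqP [eia ekj]].
    by subst a k; have := subT _ _ h1; rewrite /confT /asgT; arith.
  - move: he; rewrite hA hneg !inE => /or3P[/eqP //|/eqP //|/eqP [eia ekj]].
    by subst a k; move: un2; rewrite nls_cat mem_cat haT1.
  - by move: he; rewrite hB hneg !inE => /orP[] /eqP.
  - move: he; rewrite EC in_colC hneg /= => /and3P[/eqP ey _ hak]; subst y.
    have hmk := cf_low hcf hK.
    have row b : m <= b -> b <= k -> b = i.
      move=> hb1 hb2; apply/eqP; apply/negPn/negP => hbi.
      have hbj : b != j by arith.
      have := subF _ _ (h1 b hb2 hbj hbi); rewrite /confF /asgF; arith.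
    have ei : m = i by apply: row.
    have ek : k = m by have := row m.+1; arith.
    subst i k; left; split=> //; split=> //.
    case: (T2) (ds_tail hD) un1 => // e0 T2' [h0 _ _].
    by rewrite nls_cat mem_cat in_cons h0 eqxx orbT.
split.
- apply: descent_rcons (descent_uniq _ _ hD hun) _ => //; first exact: descent_lev hD.
  have := ds_tail hD; case: claim => [[h1 [h2 ->]]|[[e0 [T2' ->]] [h1 h2]]] /=.
    by split=> //; rewrite h2.
  move=> [t1 t2 t3]; split=> // e' i; rewrite mem_rcons in_cons => /orP[/eqP -> /=|].
    by rewrite h1 => hi [<-]; exists C; rewrite (negbTE haj).
  exact: t3.
- by rewrite -rcons_cat E rcons_cat.
- by [].
- by [].
- move=> e'; rewrite mem_rcons in_cons => /orP[/eqP -> /=|/hT2 //].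
  by case: claim => [[h1 _]|[_ [h1 _]]]; [left|right; exists a].
Qed.

End Descending.
End Conflicts.

Section Stages.

Variable N : nat.
Local Notation var := (op_var N.+1).
Local Notation lit := (literal (op_var N.+1)).
Local Notation cls := (clause (op_var N.+1)).
Implicit Types (l : lit) (C D : cls) (P Q T X : trail (op_var N.+1)).

Variables (F : {set cls}) (L : seq cls) (KD : nat -> nat -> bool).
Local Notation db := (database F L).
Hypothesis hdb : db_spec F L KD.

Variables (g f : bool) (j c m : nat).
Hypothesis hcf : config N KD g f j c m.

Local Notation descent := (@descent N g f j c m).
Local Notation stage1 := (@stage1 N g f j c m).
Local Notation stage2 := (@stage2 N g f j c m).
Local Notation stage3 := (@stage3 N g f j c m).
Local Notation conflictT := (confT g j c m).
Local Notation conflictF := (confF g f j c m).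
Local Notation after_pivot := (@after_pivot N g c m).

Lemma stage1_dequeue tgt P e Q :
  stage1 tgt P (e :: Q) -> settled F L (rcons P e) (P ++ e :: Q) ->
  stage1 tgt (rcons P e) Q \/ stage2 tgt (rcons P e) Q.
Proof.
move=> [T1 [T2 [hD E hsz hcol hT2]]] hs.
have [hjm hmN] := andP (cf_jm hcf).
have hP : rcons P e = take (size P).+1 T1.
  have := congr1 (take (size P).+1) E.
  rewrite -cat_rcons takel_cat ?size_rcons // -{1}(size_rcons P e) take_size.
  by move=> ->; rewrite takel_cat.
have [hlt|hge] := ltnP (size P).+1 (size T1).
  left; exists T1, T2; split=> //; rewrite ?cat_rcons ?size_rcons // => e' he'.
  apply: hcol; move: he'; rewrite -[(size P).+1]add1n -drop_drop.
  exact: mem_drop.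
right; have {}hP : rcons P e = T1 by rewrite hP take_oversize.
have {}E : Q = T2.
  have := congr1 (drop (size T1)) E; rewrite -cat_rcons hP.
  by rewrite !drop_size_cat.
rewrite -cat_rcons hP E in hs.
have [e1 e2] := ds_eq hD.
have hsub : {subset nls T1 <= nls (T1 ++ T2)} by move=> t ht; rewrite nls_cat mem_cat ht.
have hpiv : (m, j, true) \in nls (T1 ++ T2).
  have [||a ha haj ham|//|] := forcedC (i := m) hdb hs hsub (cf_pivot hcf); try arith.
    by rewrite e2 /asgF; arith.
  have hs2 : sub_asg (T1 ++ T2) conflictT conflictF.
    by apply: descent_sub hD _ => e' /hT2[|]; [left|right; left].
  move/(proj2 hs2); have := cf_c hcf; have := cf_f hcf.
  by rewrite /confF /asgF; arith.
case: T2 => [|e0 T2] in hD hT2 E hs hsub hpiv *.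
  by move: hpiv; rewrite cats0 (negbTE (descent_new0 hcf hD)).
exists e0, T2; split; rewrite ?hP // => e' he'.
have /hT2 [h|] : e' \in e0 :: T2 by rewrite in_cons he' orbT.
  have [h0 _ _] := ds_tail hD; have := ds_uniq hD.
  rewrite /tvars map_cat cat_uniq /= => /and4P[_ _ /negP h1 _].
  by case: h1; apply/mapP; exists e' => //; rewrite (mk_eq h0) (mk_eq h).
by left.
Qed.

Lemma stage2_sub tgt P Q : stage2 tgt P Q -> sub_asg (P ++ Q) conflictT conflictF.
Proof.
move=> [e0 [T2 [hD -> hT2]]]; have [h0 _ _] := ds_tail hD.
by apply: descent_sub hD _ => e; rewrite in_cons => /orP[/eqP -> |/hT2]; [left|right].
Qed.

Lemma stage2_grow tgt P Q C l :
  stage2 tgt P Q -> C \in db -> unit_at (P ++ Q) C l ->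
  (exists e Q', Q = e :: Q' /\ neg (elit e) \in C) \/ C = [set l] ->
  stage2 tgt P (rcons Q (Entry l (level (P ++ Q)) (Some C))).
Proof.
move=> h2 hC hu hhd; have [subT subF] := stage2_sub h2.
case: h2 => e0 [T2 [hD EQ hT2]].
have [hjm hmN] := andP (cf_jm hcf); have hc := cf_c hcf; have hf := cf_f hcf.
have [e1 e2] := ds_eq hD; have [h0 hr0 hr] := ds_tail hD.
have hun := proj1 (andP (proj2 (andP hu))).
have [un1 un2] := (unassigned_nl true hun, unassigned_nl false hun).
case: hhd => [[e [Q' [EQ' he]]]|hsing]; last first.
  exfalso; apply: (not_singleton hdb hcf hC hu _ hsing) => hg.
  by rewrite nls_cat mem_cat e1 /asgT hg !eqxx.
have hneg : nl (neg (elit e)) = (m, j, false).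
  by move: EQ'; rewrite EQ => -[<- _]; rewrite nl_neg h0.
have hpiv : (m, j, true) \in nls (P ++ Q).
  by rewrite EQ nls_cat mem_cat in_cons h0 eqxx orbT.
have claim : (exists i, [/\ i < m, nl l = (i, m, false) &
      if i == j then isB C j m else isA C i m j]) \/ g /\ nl l = (m, c, true).
  move: (unit_casesP hdb hC hu) un1 un2; case E' : _ / => [i y k hA hd h1 h2|i y k hA hd h1 h2|i y k hA hd h1 h2|i y hB hd h1|i y k hK EC hi h1] /=;
    rewrite ?E' /= => un1 un2.
  - move: he; rewrite hA hneg !inE => /or3P[/eqP [ei ey]|/eqP [ey ek]|/eqP //].
      by subst i y; rewrite un1 in hpiv.
    subst y k; have him : i < m by have := subF _ _ h2; rewrite /confF /asgF; arith.
    by left; exists i; have -> : (i == j) = false by arith.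
  - move: he; rewrite hA hneg !inE => /or3P[/eqP [ei ey]|/eqP [ey ek]|/eqP //].
      by subst i y; have := subF _ _ h2; rewrite /confF /asgF; arith.
    by subst y k; rewrite un1 in hpiv.
  - move: he; rewrite hA hneg !inE => /or3P[/eqP [ei ey]|/eqP [ey ek]|/eqP //].
      subst i y; have [hg ->] : g /\ k = c.
        by have := subT _ _ h2; rewrite /confT /asgT; arith.
      by right.
    by subst y k; have := subT _ _ h1; rewrite /confT /asgT; arith.
  - move: he; rewrite hB hneg !inE => /orP[/eqP [ei ey]|/eqP [ey ei]].
      by subst i y; rewrite un1 in hpiv.
    by subst i y; left; exists j; rewrite eqxx.
  - by move: he; rewrite EC in_colC hneg.
rewrite EQ in hu hun un1 un2 *; rewrite rcons_cons.
exists e0, (rcons T2 (Entry l (level (P ++ e0 :: T2)) (Some C))); split=> //.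
- rewrite -rcons_cons; apply: descent_rcons (descent_uniq _ _ hD hun) _ => //.
    exact: descent_lev hD.
  rewrite rcons_cons; split=> // e' i; rewrite mem_rcons in_cons => /orP[/eqP -> /=|]; last exact: hr.
  move=> hi; case: claim => [[a [ha -> hif]] [<-]|[_ ->] //].
  by exists C.
- move=> e'; rewrite mem_rcons in_cons => /orP[/eqP -> /=|/hT2 //].
  by case: claim => [[a [ha h _]]|]; [left; exists a|right].
Qed.

Lemma stage2_full tgt P e Q :
  stage2 tgt P (e :: Q) -> settled F L (rcons P e) (P ++ e :: Q) ->
  forall i, i < m -> (i, m, false) \in nls Q.
Proof.
move=> h2 hs i hi; have [subT subF] := stage2_sub h2.
case: h2 => e0 [T2 [hD [? ?] hT2]]; subst e0 T2.
have [hjm hmN] := andP (cf_jm hcf); have hc := cf_c hcf; have hf := cf_f hcf.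
have [e1 e2] := ds_eq hD; have [h0 _ _] := ds_tail hD.
have hsub : {subset nls (rcons P e) <= nls (P ++ e :: Q)}.
  by move=> t ht; rewrite -cat_rcons nls_cat mem_cat ht.
have hpiv : (m, j, true) \in nls (rcons P e).
  by rewrite /nls map_rcons mem_rcons -h0 mem_head.
have : (i, m, true) \in nls (P ++ e :: Q) \/ (i, m, false) \in nls (P ++ e :: Q).
  have [->|hij] := eqVneq i j; first by apply: (forcedB hdb hs hsub hpiv); arith.
  apply: (forcedA hdb hs hsub hpiv); try arith.
  rewrite /nls map_rcons mem_rcons in_cons -/(nls P) e2 /asgF; arith.
case=> [/subT|]; first by rewrite /confT /asgT; arith.
rewrite nls_cat mem_cat (negbTE (descent_new hcf hD hi)) in_cons h0.
by rewrite !xpair_eqE /= andbF.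
Qed.

Lemma stage2_dequeue wT wF tgt P e Q :
  stage2 tgt P (e :: Q) -> settled F L (rcons P e) (P ++ e :: Q) ->
  stage3 wT wF tgt (rcons P e) Q.
Proof.
move=> h2 hs; have hfull := stage2_full h2 hs.
case: h2 => e0 [T2 [hD [? ?] hT2]]; subst e0 T2.
have h0m : 0 < m by have := cf_m hcf; arith.
exists P, e, [::], Q, [::]; rewrite cats0 cats1 /=; split=> //; split=> //.
by case: Q hfull {hD hs hT2} => [/(_ 0 h0m)|].
Qed.

Section Final.

Variables wT wF : nat -> nat -> bool.
Hypothesis hfin : final F L KD g f j c m wT wF.

Lemma conf_final T : sub_asg T conflictT conflictF -> sub_asg T wT wF.
Proof.
by case=> h1 h2; split=> i y => [/h1|/h2]; [apply: fn_subT hfin _ _|apply: fn_subF hfin _ _].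
Qed.

Lemma stage3_sub tgt P Q : stage3 wT wF tgt P Q ->
  sub_asg (P ++ Q) wT wF /\ (forall i, i < m -> (i, m, false) \in nls (P ++ Q)).
Proof.
move=> [T1 [e0 [X1 [X2 [Y [hD -> [-> _] [hX hall] [hY1 hY2]]]]]]].
have E : (T1 ++ e0 :: X1) ++ X2 ++ Y = (T1 ++ e0 :: X1 ++ X2) ++ Y.
  by rewrite -!catA /= -catA.
have [h0 hr0 hr] := ds_tail hD.
have [subT subF] : sub_asg (T1 ++ e0 :: X1 ++ X2) wT wF.
  apply: conf_final; have [e1 e2] := ds_eq hD.
  split=> i y; rewrite nls_cat mem_cat in_cons => /or3P[h|/eqP h|/mapP[e he hn]].
  - by rewrite /confT -e1 h.
  - by move: h; rewrite h0 => -[-> ->]; rewrite /confT !eqxx orbT.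
  - case: (hX e he) => [[a [_]]|[hg]]; rewrite -hn // => -[-> ->].
    by rewrite /confT hg !eqxx !orbT.
  - by rewrite /confF -e2 h.
  - by move: h; rewrite h0.
  - case: (hX e he) => [[a [ha]]|[hg]]; rewrite -hn // => -[-> ->].
    by rewrite /confF ha eqxx orbT.
rewrite E; split=> [|i hi].
  by split=> i y; rewrite nls_cat mem_cat => /orP[]; auto.
by have h := hall i hi; rewrite nls_cat mem_cat nls_cat mem_cat in_cons h !orbT.
Qed.

Lemma stage3_grow tgt P Q C l :
  stage3 wT wF tgt P Q -> C \in db -> unit_at (P ++ Q) C l ->
  (exists e Q', Q = e :: Q' /\ neg (elit e) \in C) \/ C = [set l] ->
  stage3 wT wF tgt P (rcons Q (Entry l (level (P ++ Q)) (Some C))).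
Proof.
move=> h3 hC hu hhd; have [hsub hall] := stage3_sub h3.
case: h3 => T1 [e0 [X1 [X2 [Y [hD EP [EQ hne] [hX hallX] hY]]]]].
have hun := proj1 (andP (proj2 (andP hu))).
have [un1 un2] := (unassigned_nl true hun, unassigned_nl false hun).
have [h0 hr0 hr] := ds_tail hD; have [e1 e2] := ds_eq hD.
case: hhd => [[e [Q' [EQ' he]]]|hsing]; last first.
  exfalso; apply: (not_singleton hdb hcf hC hu _ hsing) => hg.
  by rewrite EP !nls_cat !mem_cat e1 /asgT hg !eqxx.
have eX : e \in X1 ++ X2.
  move: EQ' hne; rewrite EQ; case: (X2) => //= a X2' [-> _] _.
  by rewrite mem_cat mem_head orbT.
have hl := fn_unit hfin hsub hall hC hu (ex_intro _ (elit e) (conj he (hX e eX))).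
have ET : P ++ Q = T1 ++ e0 :: X1 ++ X2 ++ Y by rewrite EP EQ -!catA.
rewrite ET in hu hun un1 un2 hall *.
exists T1, e0, X1, X2, (rcons Y (Entry l (level (T1 ++ e0 :: X1 ++ X2 ++ Y)) (Some C))).
split=> //.
- rewrite -!rcons_cat -rcons_cons; apply: descent_rcons (descent_uniq _ _ hD hun) _ => //.
    exact: descent_lev hD.
  rewrite rcons_cons; split=> // e' i; rewrite mem_rcons in_cons => /orP[/eqP -> /= hi hn|]; last exact: hr.
  by move: un2; rewrite hn (hall i hi).
- by rewrite EQ rcons_cat.
- by apply: sub_asg_rcons hY _ _ => i y /= E; move: hl; rewrite E.
Qed.

Lemma stage3_dequeue tgt P e Q :
  stage3 wT wF tgt P (e :: Q) -> settled F L (rcons P e) (P ++ e :: Q) ->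
  stage3 wT wF tgt (rcons P e) Q.
Proof.
move=> [T1 [e0 [X1 [[|e' X2] [Y [hD EP [EQ hne] [hX hallX] hY]]]]]] hs //.
case: EQ => ? EQ; subst e'.
exists T1, e0, (rcons X1 e), X2, Y; split=> //; rewrite ?cat_rcons //.
  by rewrite EP rcons_cat rcons_cons.
split=> //; apply/eqP => E2; subst X2; rewrite cats1 in hallX.
have [/negP h _] := settledP _ _ _ _ hs _ (dbC hdb (fn_col hfin)); apply: h.
apply/falsified_nls => l; rewrite in_colC nl_neg.
case: (nl l) => [[i y] s] /= /and4P[-> /eqP -> hi him].
rewrite EP rcons_cat rcons_cons nls_cat mem_cat in_cons hallX ?orbT //; arith.
Qed.

Lemma stage12_learn tgt P Q C :
  stage1 tgt P Q \/ stage2 tgt P Q -> C \in db -> falsified (P ++ Q) C ->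
  learn (P ++ Q) C = tgt /\ 0 < level (P ++ Q).
Proof.
move=> h hC hf.
have [T1 [T2 [hD E hsub]]] : exists T1 T2, [/\ descent tgt T1 T2, P ++ Q = T1 ++ T2
    & sub_asg (P ++ Q) conflictT conflictF].
  case: h => [[T1 [T2 [hD -> _ _ hT2]]]|h].
    exists T1, T2; split=> //.
    by apply: descent_sub hD _ => e' /hT2[|]; [left|right; left].
  have := stage2_sub h; case: h => e0 [T2 [hD -> _]] hs.
  by exists P, (e0 :: T2).
have EC := fn_falsified hfin (conf_final hsub) hC hf.
by rewrite EC E in hf *; exact: (descent_learn hcf hD hf).
Qed.

Lemma stage3_learn tgt P Q C :
  stage3 wT wF tgt P Q -> C \in db -> falsified (P ++ Q) C ->
  learn (P ++ Q) C = tgt /\ 0 < level (P ++ Q).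
Proof.
move=> h hC hf; have [hsub _] := stage3_sub h.
have EC := fn_falsified hfin hsub hC hf; rewrite EC in hf *.
case: h hf => T1 [e0 [X1 [X2 [Y [hD -> [-> _] _ _]]]]].
by rewrite -!catA /= => hf; exact: (descent_learn hcf hD hf).
Qed.

End Final.
End Stages.

Section Finals.

Variable N : nat.
Local Notation var := (op_var N.+1).
Local Notation lit := (literal (op_var N.+1)).
Local Notation cls := (clause (op_var N.+1)).
Implicit Types (l : lit) (C D : cls) (P Q T X : trail (op_var N.+1)).

Variables (F : {set cls}) (L : seq cls) (KD : nat -> nat -> bool).
Local Notation db := (database F L).
Hypothesis hdb : db_spec F L KD.

Section Top.

Variables (g f : bool) (j c : nat).
Hypothesis hcf : config N KD g f j c N.
Hypothesis hNN : KD N N.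
Hypothesis above : forall y k, KD y k -> y != N ->
  [|| k == N, (y != j) && (j <= k) | [&& g, y != j, y != c & c <= k]].

(* A linear order whose least element is [N]: it satisfies every clause of the
   database except [D(N)]. *)
Definition rank i :=
  if i == N then 0 else if i == j then 1 else if g && (i == c) then 2 else i.+3.

Lemma final_top :
  final F L KD g f j c N (fun i y => rank i < rank y) (fun i y => rank y <= rank i).
Proof.
have [hjN _] := andP (cf_jm hcf); have hc := cf_c hcf; have hf := cf_f hcf.
have r0 i : i = N -> rank i = 0 by move=> ->; rewrite /rank eqxx.
have r1 i : i = j -> rank i = 1 by move=> ->; rewrite /rank eqxx ifN //; arith.
have r2 i : g -> i = c -> rank i = 2.
  by move=> hg ->; have := hc hg => ?; rewrite /rank hg eqxx !ifN //; arith.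
have r3 i : i != N -> i != j -> ~~ (g && (i == c)) -> rank i = i.+3.
  by move=> h1 h2 h3; rewrite /rank !ifN.
have rpos i : i != N -> 0 < rank i.
  by move=> h1; rewrite /rank (negbTE h1); do !case: ifP.
have low y k : KD y k -> y != N -> exists b, [/\ b <= k, b != y & rank b < rank y].
  move=> hK hy; have hle := dbK hdb hK; have hk : y = j -> N <= k.
    by move=> E; subst y; apply: (cf_low hcf).
  case/or3P: (above hK hy) => [hkN|/andP[hyj hjk]|/and4P[hg hyj hyc hck]].
  - by exists N; rewrite (r0 N) // rpos //; split=> //; arith.
  - exists j; rewrite (r1 j) //; split=> //; first arith.
    by rewrite /rank (negbTE hy) (negbTE hyj); case: ifP.
  - exists c; rewrite (r2 c) // (r3 y) //; last by rewrite hg.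
    by split=> //; arith.
split.
- move=> i y; rewrite /confT /asgT => /or3P[/and3P[hg /eqP -> /eqP ->]|/andP[/eqP -> /eqP ->]|/and3P[hg /eqP -> /eqP ->]].
  + by rewrite (r1 j) // (r2 c).
  + by rewrite (r1 j) // (r0 N).
  + by rewrite (r0 N) // (r2 c).
- move=> i y; rewrite /confF /asgF => /orP[/or3P[/and3P[/eqP -> hi hij]|/and3P[hg /eqP -> /eqP ->]|/and5P[hff /eqP -> hi hij hic]]|/andP[/eqP -> _]].
  + by rewrite (r1 j) // rpos //; arith.
  + by rewrite (r1 j) // (r2 c).
  + by rewrite (r2 c) ?(r3 i) //; [arith|rewrite negb_and hic orbT|exact: hf].
  + by rewrite (r0 N).
- exact: hNN.
- move=> T C [sT sF] hC hfal.
  case: (falsified_casesP hdb hC hfal) => [i y k _ _ h1 h2 h3|i y _ _ h1 h2|y k hK EC h].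
  + by have := sT _ _ h1; have := sT _ _ h2; have := sF _ _ h3; arith.
  + by have := sT _ _ h1; have := sT _ _ h2; arith.
  + have [ey|hy] := eqVneq y N.
      by rewrite EC ey; have -> : k = N by have := dbK hdb hK; arith.
    have [b [hb hby hr]] := low _ _ hK hy.
    by have := sF _ _ (h _ hb hby); arith.
- move=> T C l [sT sF] hall hC hu _.
  have hun := unassigned_nl false (proj1 (andP (proj2 (andP hu)))).
  case: (unit_casesP hdb hC hu) hun => [i y k _ _ h1 h2|i y k _ _ h1 h2|i y k _ _ h1 h2|i y _ _ h1|i y k hK EC hi h] /= hun.
  + by have := sT _ _ h1; have := sF _ _ h2; arith.
  + by have := sT _ _ h1; have := sF _ _ h2; arith.
  + by have := sT _ _ h1; have := sT _ _ h2; arith.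
  + by have := sT _ _ h1; arith.
  + have hle := dbK hdb hK; have [ey|hy] := eqVneq y N.
      by subst y; move: hun; rewrite hall //; arith.
    have [b [hb hby hr]] := low _ _ hK hy; have [<- //|hbi] := eqVneq b i.
    by have := sF _ _ (h _ hb hby hbi); arith.
Qed.

End Top.

Section Small.

Variables (g f : bool) (j c m : nat).
Hypothesis hcf : config N KD g f j c m.
Hypotheses (hm : m.+2 <= N) (hmm : KD m m).

Definition smallT i y :=
  [|| confT g j c m i y, (i == m.+1) && (y == m) | [&& g, i == m.+1 & y == c]].
Definition smallF i y := confF g f j c m i y || (y == m.+1) && (i < m).

(* The clauses [colC m k] with [k > m] keep at least two unassigned variables
   until [P_{m+1,m}] is propagated. *)
Lemma final_small : final F L KD g f j c m smallT smallF.
Proof.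
have [hjm _] := andP (cf_jm hcf); have hc := cf_c hcf; have hf := cf_f hcf.
split=> //.
- by move=> i y; rewrite /smallT => ->.
- by move=> i y; rewrite /smallF => ->.
- move=> T C [sT sF] hC hfal.
  case: (falsified_casesP hdb hC hfal) => [i y k _ _ h1 h2 h3|i y _ _ h1 h2|y k hK EC h].
  + have := sT _ _ h1; have := sT _ _ h2; have := sF _ _ h3.
    by rewrite /smallT /smallF /confT /confF /asgT /asgF; arith.
  + have := sT _ _ h1; have := sT _ _ h2.
    by rewrite /smallT /confT /asgT; arith.
  + have hle := dbK hdb hK.
    have row a : a <= k -> a != y -> smallF a y by move=> h1 h2; apply: sF; apply: h.
    have [ey|hym] := eqVneq y m.
      subst y; have [hk|hk] := ltnP m k; last by rewrite EC; congr colC; arith.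
      by have := row m.+1; rewrite /smallF /confF /asgF; arith.
    exfalso; have [ey|hyj] := eqVneq y j.
      by subst y; have := cf_low hcf hK; have := row m; rewrite /smallF /confF /asgF; arith.
    have [ey|hym1] := eqVneq y m.+1.
      by subst y; have := row m; rewrite /smallF /confF /asgF; arith.
    have [hgc|hyc] := boolP (g && (y == c)).
      have [hg /eqP ey] := andP hgc; subst y; have := cf_shadow hcf hg hK.
      by have := row j; rewrite /smallF /confF /asgF; arith.
    have hk2 : 2 <= k by apply: (cf_other hcf hK hyj) => hg; move: hyc; rewrite hg.
    have := row 0; have := row 1; rewrite /smallF /confF /asgF; arith.
- move=> T C l [sT sF] hall hC hu [h [hh hhead]].
  have hun := proj1 (andP (proj2 (andP hu))).
  have := unassigned_nl true hun; have := unassigned_nl false hun.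
  case: (unit_casesP hdb hC hu) => [i y k hA hd h1 h2|i y k hA hd h1 h2|i y k hA hd h1 h2|i y hB hd h1|i y k hK EC hi h1] /= un1 un2.
  + move: hh; rewrite hA nl_neg !inE; have := sT _ _ h1; have := sF _ _ h2.
    by case: hhead => [[a [ha ->]]|[hg ->]] /=; move=> {un1 un2} S1 S2 /or3P[] /eqP // [*]; subst;
      move: S1 S2; rewrite /smallT /smallF /confT /confF /asgT /asgF; arith.
  + move: hh; rewrite hA nl_neg !inE; have := sT _ _ h1; have := sF _ _ h2.
    by case: hhead => [[a [ha ->]]|[hg ->]] /=; move=> {un1 un2} S1 S2 /or3P[] /eqP // [*]; subst;
      move: S1 S2; rewrite /smallT /smallF /confT /confF /asgT /asgF; arith.
  + move: hh; rewrite hA nl_neg !inE; have := sT _ _ h1; have := sT _ _ h2.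
    case: hhead => [[a [ha ->]]|[hg ->]] /= S1 S2.
      by case/or3P => /eqP // [? ?]; subst; rewrite hall in un1.
    by case/or3P => /eqP // [? ?]; subst; move: S1 S2;
      rewrite /smallT /smallF /confT /confF /asgT /asgF; arith.
  + move: hh; rewrite hB nl_neg !inE; have := sT _ _ h1.
    by case: hhead => [[a [ha ->]]|[hg ->]] /=; move=> {un1 un2} S1 /orP[] /eqP // [*]; subst;
      move: S1; rewrite /smallT /smallF /confT /confF /asgT /asgF; arith.
  + move: hh; rewrite EC in_colC nl_neg.
    case: hhead => [[a [ha ->]]|[hg ->]] //= /and3P[/eqP ey _ _]; subst y.
    have hle := dbK hdb hK.
    have him : m < i.
      have [him|] := ltnP i m; last by arith.
      by rewrite hall in un1.
    have [ei|hi1] := eqVneq i m.+1; first by rewrite /smallT ei !eqxx orbT.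
    have hi' : m.+1 <= i by arith.
    have := sF _ _ (h1 m.+1 _ _ _); rewrite /smallF /confF /asgF.
    have [b1 b2] : m.+1 <= k /\ m.+1 != m by arith.
    by move=> /(_ b1 b2); rewrite eq_sym hi1 => /(_ isT); arith.
Qed.

End Small.

Record stable (S : trail var -> trail var -> Prop) (tgt : cls) : Prop := Stable {
  st_grow : forall P Q C l, S P Q -> C \in db -> unit_at (P ++ Q) C l ->
    (exists e Q', Q = e :: Q' /\ neg (elit e) \in C) \/ C = [set l] ->
    S P (rcons Q (Entry l (level (P ++ Q)) (Some C)));
  st_dequeue : forall P e Q, S P (e :: Q) -> settled F L (rcons P e) (P ++ e :: Q) ->
    S (rcons P e) Q;
  st_learn : forall P Q C, S P Q -> C \in db -> falsified (P ++ Q) C ->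
    learn (P ++ Q) C = tgt /\ 0 < level (P ++ Q);
  st_queue : forall P, ~ S P [::]
}.

Lemma stage1_queue g f j c m tgt P : ~ @stage1 N g f j c m tgt P [::].
Proof.
move=> [T1 [T2 [_ E hsz _ _]]]; have := congr1 size E.
by rewrite cats0 size_cat; arith.
Qed.

Lemma stable_single g f j c m wT wF tgt :
  config N KD g f j c m -> final F L KD g f j c m wT wF ->
  stable (fun P Q => [\/ @stage1 N g f j c m tgt P Q, @stage2 N g f j c m tgt P Q
                      | @stage3 N g f j c m wT wF tgt P Q]) tgt.
Proof.
move=> hcf hfin; split.
- move=> P Q C l [h|h|h] hC hu hhd.
  + by constructor 1; exact: (stage1_grow hdb hcf h hC hu hhd).
  + by constructor 2; exact: (stage2_grow hdb hcf h hC hu hhd).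
  + by constructor 3; exact: (stage3_grow hdb hcf hfin h hC hu hhd).
- move=> P e Q [h|h|h] hs.
  + by case: (stage1_dequeue hdb hcf h hs) => h'; [constructor 1|constructor 2].
  + by constructor 3; exact: (stage2_dequeue hdb hcf _ _ h hs).
  + by constructor 3; exact: (stage3_dequeue hdb hfin h hs).
- move=> P Q C [h|h|h] hC hf.
  + by apply: (stage12_learn hcf hfin _ hC hf); left.
  + by apply: (stage12_learn hcf hfin _ hC hf); right.
  + exact: (stage3_learn hcf hfin h hC hf).
- move=> P [h|h|h]; first exact: stage1_queue h.
    by case: h => ? [? [_ //]].
  by case: h => ? [? [? [[|a X2] [? [_ _ [//]]]]]].
Qed.

Lemma stage2_double j m tgt P e Q :
  config N KD false false j j m -> config N KD true true m j m.+1 ->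
  @stage2 N false false j j m tgt P (e :: Q) ->
  settled F L (rcons P e) (P ++ e :: Q) ->
  @stage1 N true true m j m.+1 tgt (rcons P e) Q.
Proof.
move=> hcf hcf' h2 hs; have hfull := stage2_full hdb hcf h2 hs.
case: h2 => e0 [T2 [hD [? ?] hT2]]; subst e0 T2.
have [hjm hmN] := andP (cf_jm hcf); have h2m := cf_m hcf.
have [e1 e2] := ds_eq hD; have [h0 _ _] := ds_tail hD.
have hl := descent_lev hD.
have hall i : i < m -> (i, m, false) \in nls (P ++ e :: Q).
  by move=> hi; rewrite nls_cat mem_cat in_cons hfull ?orbT.
have lQ t : t \in nls Q -> exists i, i < m /\ t = (i, m, false).
  by case/mapP=> e' /hT2[[i [hi E]]|[//]] ->; exists i.
exists (P ++ e :: Q), [::]; split=> //.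
- split=> //=.
  + split=> i y; rewrite nls_cat mem_cat in_cons h0 ?e1 ?e2 /asgT /asgF /=.
      rewrite !xpair_eqE andbT.
      have -> : ((i, y, true) \in nls Q) = false.
        by apply/negbTE/negP => /lQ[a [_ []]].
      by rewrite orbF.
    rewrite !xpair_eqE andbF /=.
    have -> : ((i, y, false) \in nls Q) = (y == m) && (i < m).
      apply/idP/idP => [/lQ[a [ha [-> ->]]]|/andP[/eqP -> /hfull //]].
      by rewrite eqxx.
    by arith.
  + exact: (descent_base hcf hD hall).
  + have [h0m b1] : 0 < m /\ (0 < m.+1) && (0 != m) by arith.
    have /mapP[e' he' E] := hfull 0 h0m; exists 0, e'; split=> //.
      by rewrite mem_cat in_cons he' !orbT.
    have /allP /(_ e') := ds_prop hD; rewrite in_cons he' orbT => /(_ isT) /andP[_ /eqP ->].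
    by rewrite hl.
  + by rewrite hl; exact: ds_level hD.
  + by rewrite cats0; exact: ds_uniq hD.
- by rewrite cats0 cat_rcons.
- have := hfull 0; rewrite size_rcons size_cat /= => /(_ _)/mapP h.
  have [|e' he' _] := h; first arith.
  by case: (Q) he' => //= a s _; rewrite !addnS !ltnS leq_addr.
- move=> e'; rewrite -cat_rcons drop_size_cat // => /hT2[[i [hi E]]|[//]].
  by exists i; split=> //; arith.
Qed.

Lemma double_consistent j m wT wF T C :
  config N KD false false j j m -> final F L KD true true m j m.+1 wT wF ->
  sub_asg T (confT false j j m) (confF false false j j m) -> C \in db -> ~~ falsified T C.
Proof.
move=> hcf hfin [subT subF] hC; apply/negP => hf.
have [hjm hmN] := andP (cf_jm hcf); have h2m := cf_m hcf.
have hsub : sub_asg T wT wF.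
  split=> i y.
    by move/subT => h'; apply: (fn_subT hfin); move: h'; rewrite /confT /asgT; arith.
  by move/subF => h'; apply: (fn_subF hfin); move: h'; rewrite /confF /asgF; arith.
have EC := fn_falsified hfin hsub hC hf.
have hbig := dbK hdb (fn_col hfin).
have /falsified_nls /(_ (mk N 0 m.+1 true)) := hf.
rewrite EC in_colC nl_neg nl_mk //=; last by arith.
by rewrite eqxx => /(_ isT) /subF; rewrite /confF /asgF; arith.
Qed.

Lemma stable_double j m wT wF tgt :
  config N KD false false j j m -> config N KD true true m j m.+1 -> m.+1 = N ->
  final F L KD true true m j m.+1 wT wF ->
  stable (fun P Q => (@stage1 N false false j j m tgt P Q \/
                      @stage2 N false false j j m tgt P Q) \/
    [\/ @stage1 N true true m j m.+1 tgt P Q, @stage2 N true true m j m.+1 tgt P Q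
      | @stage3 N true true m j m.+1 wT wF tgt P Q]) tgt.
Proof.
move=> hcf hcf' hm hfin; have st := stable_single tgt hcf' hfin; split.
- move=> P Q C l [[h|h]|h] hC hu hhd; last by right; apply: (st_grow st).
  + by left; left; exact: (stage1_grow hdb hcf h hC hu hhd).
  + by left; right; exact: (stage2_grow hdb hcf h hC hu hhd).
- move=> P e Q [[h|h]|h] hs; last by right; apply: (st_dequeue st).
  + by left; apply: (stage1_dequeue hdb hcf h hs).
  + by right; constructor 1; apply: stage2_double.
- move=> P Q C [h|h] hC hf; last exact: (st_learn st h hC hf).
  exfalso; have hsub : sub_asg (P ++ Q) (confT false j j m) (confF false false j j m).
    case: h => [[T1 [T2 [hD -> _ _ hT2]]]|/stage2_sub //].
    by apply: descent_sub hD _ => e' /hT2[|]; [left|right; left].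
  by case/negP: (double_consistent hcf hfin hsub hC).
- move=> P [[h|h]|h]; [exact: stage1_queue h| |exact: (st_queue st h)].
  by case: h => ? [? [_ //]].
Qed.

End Finals.

(** * From a restart to the next conflict *)

Section Phase.

Variable N : nat.
Local Notation var := (op_var N.+1).
Local Notation lit := (literal (op_var N.+1)).
Local Notation cls := (clause (op_var N.+1)).
Implicit Types (l : lit) (C D : cls) (P Q T X : trail (op_var N.+1)).

Variables (R : realFieldType) (delta : R) (F : {set cls}) (vars : seq var).
Variables (L : seq cls) (KD : nat -> nat -> bool).
Local Notation db := (database F L).
Hypothesis hdb : db_spec F L KD.

Variables (g f : bool) (j c m d : nat).
Hypothesis hcf : config N KD g f j c m.

Local Notation x := (if f then c else j).

(* [d] is the last row decided before the conflict. *)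
Record decisions : Prop := Decisions {
  dc_d : (d < m) && (d != j);
  dc_last : forall i, d < i -> i < m -> i = j;
  dc_c : g -> d != c;
  dc_f : f -> (j < d) && ((0 < j) ==> (j.-1 != c));
  dc_implied : g -> exists k, [/\ KD c k, j <= k
      & forall a, a <= k -> a != c -> a != j -> f && (a < j)];
  dc_choice : forall P v, vsids_choice delta vars L P v ->
    (forall s, (d, x, s) \notin nls P) ->
    exists i, [/\ (i <= d) && (i != x), v = (inord i, inord x)
      & forall a, a < i -> a != x -> exists s, (a, x, s) \in nls P]
}.

Hypothesis hdc : decisions.

(* The assignment once the rows below [b] of column [x] are decided. *)
Definition preT b i y := ~~ (f && (b < j)) && asgT g j c i y.
Definition preF b i y :=
  (f && (b < j)) && [&& y == c, i < b & i != c]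
  || ~~ (f && (b < j)) && asgF g f j c b i y.

Record pre b P Q : Prop := Pre {
  pr_sub : sub_asg (P ++ Q) (preT b) (preF b);
  pr_decided : forall i, i < b -> i != x -> (f -> i != j) -> (i, x, false) \in nls (P ++ Q);
  pr_b : b <= d
}.

Let hjm : j < m <= N := cf_jm hcf.
Let hm2 : 2 <= m := cf_m hcf.
Let hc : g -> (c < m) && (c != j) := cf_c hcf.
Let hfg : f -> g := cf_f hcf.
Let hd : (d < m) && (d != j) := dc_d hdc.
Let hdcc : g -> d != c := dc_c hdc.
Let hjd : f -> (j < d) && ((0 < j) ==> (j.-1 != c)) := dc_f hdc.

Lemma pre_rows b y k : b <= d -> KD y k ->
  (g && (y == c)) && ~~ (f && (b < j)) \/
  exists a1 a2, [/\ [&& a1 != a2, a1 <= k, a2 <= k, a1 != y & a2 != y],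
                    ~~ preF b a1 y & ~~ preF b a2 y].
Proof.
move=> hb hK; have hle := dbK hdb hK.
case: (boolP (g && (y == c) && ~~ (f && (b < j)))) => hgc; first by left.
right; have [ey|hyj] := eqVneq y j.
  subst y; have hk := cf_low hcf hK; have [hlow|hhigh] := boolP (f && (b < j)).
    have [a1 [a2 h]] : exists a1 a2, [&& a1 != a2, a1 <= 2, a2 <= 2, a1 != j & a2 != j].
      have [->|h0] := eqVneq j 0; first by exists 1, 2.
      have [->|h1] := eqVneq j 1; first by exists 0, 2.
      by exists 0, 1; arith.
    exists a1, a2; split; first arith; rewrite /preF /asgF; arith.
  exists d, m; split; first arith; rewrite /preF /asgF (negbTE hhigh); arith.
have [/andP[hg /eqP ey]|hyc] := boolP (g && (y == c)).
  subst y; have hlow : f && (b < j) by move: hgc; rewrite hg eqxx /= negbK.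
  have hk := cf_shadow hcf hg hK.
  exists j, j.-1; split; first arith; rewrite /preF /asgF; arith.
have hk2 : 2 <= k by apply: (cf_other hcf hK hyj) => hg; move: hyc; rewrite hg.
have [a1 [a2 h]] : exists a1 a2, [&& a1 != a2, a1 <= 2, a2 <= 2, a1 != y & a2 != y].
  have [->|h0] := eqVneq y 0; first by exists 1, 2.
  have [->|h1] := eqVneq y 1; first by exists 0, 2.
  by exists 0, 1; arith.
exists a1, a2; split; first arith; rewrite /preF /asgF; arith.
Qed.

Lemma pre_unit b T C l :
  b <= d -> sub_asg T (preT b) (preF b) -> C \in db -> unit_at T C l ->
  if (nl l).2 then preT b (nl l).1.1 (nl l).1.2 else preF b (nl l).1.1 (nl l).1.2.
Proof.
move=> hb [sT sF] hC hu.
case: (unit_casesP hdb hC hu) => [i y k hA hk h1 h2|i y k hA hk h1 h2|i y k hA hk h1 h2|i y hB hk h1|i y k hK EC hi h1] /=.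
- have /andP[hh /and3P[hg /eqP ey /eqP ek]] := sT _ _ h1; subst y k.
  have := sF _ _ h2; rewrite /preF /asgF hg (negbTE hh) /=; arith.
- have /andP[hh /and3P[hg /eqP ey /eqP ek]] := sT _ _ h1; subst i y.
  have := sF _ _ h2; rewrite /preF /asgF hg (negbTE hh) /=; arith.
- have /andP[hh /and3P[hg /eqP ey /eqP ek]] := sT _ _ h1; subst i y.
  have /andP[_ /and3P[_ /eqP ey _]] := sT _ _ h2; arith.
- have /andP[hh /and3P[hg /eqP ey /eqP ek]] := sT _ _ h1; subst i y.
  by rewrite /preF /asgF hg (negbTE hh) !eqxx /= !orbT.
- have [hgc|[a1 [a2 [ha n1 n2]]]] := pre_rows hb hK.
    have [hg ey] : g /\ y = c by arith.
    subst y; have hjk := cf_shadow hcf hg hK.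
    have [ei|hij] := eqVneq i j; first by rewrite /preT /asgT ei; arith.
    have hjc : j != c by arith.
    have hji : j != i by arith.
    by have := sF _ _ (h1 j hjk hjc hji); rewrite /preF /asgF; arith.
  have [e1|hne1] := eqVneq a1 i.
    have b1 : a2 <= k by arith.
    have b2 : a2 != y by arith.
    have b3 : a2 != i by arith.
    by case/negP: n2; apply: sF; apply: h1.
  have b1 : a1 <= k by arith.
  have b2 : a1 != y by arith.
  by case/negP: n1; apply: sF; apply: h1.
Qed.

Lemma pre_consistent b T C :
  b <= d -> sub_asg T (preT b) (preF b) -> C \in db -> ~~ falsified T C.
Proof.
move=> hb [sT sF] hC; apply/negP => hf.
case: (falsified_casesP hdb hC hf) => [i y k _ hk h1 h2 h3|i y _ hk h1 h2|y k hK EC h].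
- have /andP[_ /and3P[hg _ /eqP ek]] := sT _ _ h1.
  by have /andP[_ /and3P[_ /eqP ey _]] := sT _ _ h2; arith.
- have /andP[_ /and3P[hg _ /eqP ek]] := sT _ _ h1.
  by have /andP[_ /and3P[_ /eqP ey _]] := sT _ _ h2; arith.
- have hle := dbK hdb hK; have [hgc|[a1 [a2 [ha n1 n2]]]] := pre_rows hb hK.
    have [hg ey] : g /\ y = c by arith.
    subst y; have hjk := cf_shadow hcf hg hK; have hjc : j != c by arith.
    by have := sF _ _ (h j hjk hjc); rewrite /preF /asgF; arith.
  have b1 : a1 <= k by arith.
  have b2 : a1 != y by arith.
  by case/negP: n1; apply: sF; apply: h.
Qed.

Lemma pre_full b P :
  pre b P [::] -> settled F L P P -> eq_asg P (preT b) (preF b).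
Proof.
case; rewrite cats0 => [[sT sF] hdec hb] hs.
have hsub : {subset nls P <= nls P} by [].
have hT : forall i y, preT b i y -> (i, y, true) \in nls P.
  move=> i y /andP[hhigh /and3P[hg /eqP -> /eqP ->]].
  have [k [hK hjk hrow]] := dc_implied hdc hg.
  case: (forcedC (i := j) hdb hs hsub hK hjk); first by arith.
  - move=> a hak hac haj; have /andP[hff haj'] := hrow a hak hac haj.
    by have := hdec a; rewrite hff; apply=> //; arith.
  - by [].
  - by move/sF; rewrite /preF /asgF; arith.
have hcj : g -> ~~ (f && (b < j)) -> (c, j, false) \in nls P.
  move=> hg hh; have h1 : (j, c, true) \in nls P by apply: hT; rewrite /preT /asgT hg !eqxx hh.
  case: (forcedB (i := c) hdb hs hsub h1) => //; first by arith.
  by move/sT; rewrite /preT /asgT; arith.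
split=> i y; apply/idP/idP; [exact: sT|exact: hT|exact: sF|].
case/orP => [/andP[/andP[hff hlt] /and3P[/eqP -> hi hic]]|/andP[hh]].
  by have := hdec i hi; rewrite hff; apply=> //; arith.
case/or3P => [/and3P[/eqP -> hi hij]|/and3P[hg /eqP -> /eqP ->]|/and5P[hff /eqP -> hi hij hic]].
- have [hff|hnf] := boolP f; last by have := hdec i hi; rewrite (negbTE hnf); apply.
  have hg := hfg hff.
  have [->|hic] := eqVneq i c; first exact: hcj.
  have h1 : (j, c, true) \in nls P by apply: hT; rewrite /preT /asgT hg !eqxx hh.
  have h2 : (i, c, false) \in nls P by have := hdec i hi; rewrite hff; apply.
  case: (forcedA (i := i) hdb hs hsub h1 h2) => //; try arith.
  by move/sT; rewrite /preT /asgT; arith.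
- exact: hcj.
- by have := hdec i hi; rewrite hff; apply.
Qed.

Local Notation tgt := (colC N j m.-1).

Lemma base_single T1 low cur0 :
  T1 = low ++ cur0 -> (forall e, e \in low -> elevel e < level T1) ->
  (forall i, i < m -> i != j -> i != d -> (i, j, false) \in nls low) ->
  base T1 tgt tgt.
Proof.
move=> E1 hlev hlow X hX hu; apply: resolve_back_stop.
have hl : level (T1 ++ X) = level T1 by rewrite level_cat (level_propagated hX) addn0.
have only l : l \in current_lits (T1 ++ X) tgt -> l = mk N d j true.
  rewrite inE in_colC hl => /andP[]; case El : (nl l) => [[i y] s] /=.
  have El' := mk_eq El; case/and4P=> hs /eqP hy hij him.
  move=> /hasP[e he /andP[/eqP hel /eqP hle]].
  have ne : nl (elit e) = (i, j, false) by rewrite hel nl_neg El /= hs hy.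
  have [ed|hid] := eqVneq i d; first by rewrite El' ed hy hs.
  have him' : i < m by arith.
  have hin := hlow i him' hij hid; move: he hu; rewrite E1 -catA mem_cat => /orP[he|he] hu.
    by have := hlev e he; rewrite hle ltnn.
  exfalso; apply: (uniq_nls (s' := false) hu hin).
  by rewrite -ne; apply: map_f.
by apply/card_le1_eqP => l l' /only -> /only ->.
Qed.

(* The last decision, in column [c], falsifies the last row of column [j]. *)
Definition stage0 P Q := exists dec T2,
  [/\ Q = dec :: T2, nl (elit dec) = (d, c, false) /\ f,
      eq_asg (rcons P dec) (asgT g j c)
        (fun i y => asgF g f j c m i y && ~~ ((i == d) && (y == j))),
      [/\ all (fun e => elevel e <= level P) P, elevel dec = (level P).+1
        & ereason dec = None]
    & T2 = [::] \/ exists e1, T2 = [:: e1] /\ [/\ nl (elit e1) = (d, j, false),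
        ereason e1 <> None & elevel e1 = (level P).+1]].

Lemma preF_mono b b' i y : b <= b' -> preF b i y -> preF b' i y.
Proof.
move=> hb; rewrite /preF; have [hlow|hhigh] := boolP (f && (b < j)); last first.
  have -> /= : f && (b' < j) = false.
    apply/negbTE; move: hhigh; rewrite !negb_and => /orP[-> //|h].
    by apply/orP; right; arith.
  rewrite /asgF => /or3P[/and3P[-> hi ->]|->|/and5P[-> -> hi -> ->]].
  - by rewrite (leq_trans hi hb).
  - by rewrite orbT.
  - by rewrite (leq_trans hi hb) !orbT.
have [hff hbj] := andP hlow; rewrite /= orbF => /and3P[/eqP -> hi hic].
have [hj|hj] := boolP (f && (b' < j)); first by rewrite hic (leq_trans hi hb) eqxx.
have hij : i != j by arith.
by rewrite /asgF hff (leq_trans hi hb) hic hij eqxx !orbT.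
Qed.

Lemma pre_decide b P v :
  wf F L P [::] -> pre b P [::] -> settled F L P P ->
  vsids_choice delta vars L P v ->
  let Q := [:: Entry (v, false) (level P).+1 None] in
  [\/ exists b', pre b' P Q, stage0 P Q | @stage1 N g f j c m tgt P Q].
Proof.
move=> hwf hp hs hv Q; have [e1 e2] := pre_full hp hs; have hb := pr_b hp.
have hxd : x != d by case: (f) hjd hdcc hfg => h1 h2 h3; arith.
have [|dd [hdd ev hass]] := dc_choice hdc hv.
  move=> s; apply/negP; case: s; rewrite ?e1 ?e2 /preT /preF /asgT /asgF.
    by case: (f) hjd hdcc hfg hxd => h1 h2 h3 h4; arith.
  by case: (f) hjd hdcc hfg hxd => h1 h2 h3 h4; arith.
have hvu : unassigned P v by case/and3P: hv.
have hev : nl (v, false) = (dd, x, false).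
  by rewrite ev nl_mk //; case: (f) hfg; arith.
have hun s : (dd, x, s) \in nls P = false.
  by have := unassigned_nl (l := (v, false)) s hvu; rewrite hev.
have hF a : a < dd -> a != x -> (f -> a != j) -> preF b a x.
  move=> ha hax haj; have [[]] := hass a ha hax; rewrite ?e1 ?e2 // /preT /asgT.
  by case: (f) hfg haj hax => h1 h2 h3; arith.
have hT : f -> j < dd -> ~~ (b < j).
  move=> hff hjdd; have hjx : j != x by rewrite hff; have := hc (hfg hff); arith.
  have [s] := hass j hjdd hjx; rewrite hff.
  have := hc (hfg hff); case: s; rewrite ?e1 ?e2 /preT /preF /asgT /asgF hff /=; arith.
have hbdd : b <= dd.
  have := hun true; have := hun false; rewrite e1 e2 /preT /preF /asgT /asgF.
  have [hff|hnf] := boolP f; last by rewrite (negbTE hnf) in hdd *; arith.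
  by have hg := hfg hff; rewrite hff hg /= in hdd *; arith.
have hddj : f -> dd != j.
  move=> hff; have hg := hfg hff; have hjc := hc hg; apply/negP => /eqP ej.
  have := hun true; rewrite e1 ej hff /preT /asgT hg hff !eqxx /= andbT => /negbFE hbj.
  have [hj0 hj1] : 0 < j /\ j.-1 < dd by arith.
  have hjc' : j.-1 != c by have := hjd hff; arith.
  have := hF j.-1 hj1; rewrite hff /preF /asgF hff hg => /(_ hjc'); arith.
have eQ i y s : (i, y, s) \in nls (P ++ Q) =
    ((i, y, s) \in nls P) || [&& i == dd, y == x & ~~ s].
  by rewrite nls_cat mem_cat inE hev !xpair_eqE -andbA; case: s.
have [hlt|hge] := ltnP dd d.
  constructor 1; exists dd.+1; split=> //; last first.
    move=> i hi hix hij; rewrite eQ; have [->|hne] := eqVneq i dd; first by rewrite eqxx orbT.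
    by rewrite e2 hF //; arith.
  split=> i y; rewrite eQ ?e1 ?e2 /preT /asgT.
    rewrite !andbF orbF => /andP[h1 ->]; rewrite andbT; arith.
  rewrite andbT => /orP[|/andP[/eqP -> /eqP ->]]; first by apply: preF_mono; arith.
  rewrite /preF /asgF; have [hff|hnf] := boolP f.
    by have := hddj hff; rewrite hff /= in hdd *; clear -hdd; arith.
  by rewrite (negbTE hnf) /= in hdd *; clear -hdd; arith.
have {hge} edd : dd = d by arith.
subst dd.
have hlev : all (fun e => elevel e <= level P) P.
  by have := wf_level hwf; rewrite cats0.
have huQ : uniq (tvars (P ++ Q)).
  by have := wf_uniq hwf; rewrite cats0 /tvars cats1 map_rcons rcons_uniq => ->; rewrite andbT.
have hl : level (P ++ Q) = (level P).+1 by rewrite level_cat /level /= !addn1.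
have [hff|hnf] := boolP f.
  have hg := hfg hff; have hjd' : j < d by have := hjd hff; arith.
  have hbj := hT hff hjd'; have hjc := hc hg; have hdc' := hdcc hg.
  constructor 2; exists (Entry (v, false) (level P).+1 None), [::]; split=> //; last by left.
    by split=> //; rewrite /= hev hff.
  rewrite -cats1 -/Q; split=> i y; rewrite eQ ?e1 ?e2.
    by rewrite !andbF orbF /preT hff (negbTE hbj).
  rewrite andbT hff /preF hff (negbTE hbj) /=.
  have [ed|hid] := eqVneq i d.
    by subst i; rewrite /asgF ?hff ?hg; arith.
  have hlast := @dc_last hdc i; have hFi := hF i.
  have [hid'|hid'] := ltnP i d; last first.
    have him : m <= i \/ i = j 
      by have [h|h] := leqP m i; [left|right; apply: hlast => //; rewrite ltn_neqAle eq_sym hid].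
    rewrite /asgF ?hff ?hg; move: him (hjm) (hd) hb hjd' hid hid' hdc'; clear; arith.
  move: hFi; rewrite hff => /(_ hid'); rewrite /preF ?hff (negbTE hbj) /= /asgF ?hff ?hg.
  have [eic|hic] := eqVneq i c; first by subst i; arith.
  have [eij|hij] := eqVneq i j; first by subst i; arith.
  move=> /(_ isT (fun _ => isT)) /=; move: hic hij hid hid' hjc (hjm) (hd); clear; arith.
constructor 3; rewrite -(negbTE hnf).
have hfF a : a < d -> a != j -> preF b a j.
  by have := hF a; rewrite (negbTE hnf) => h h1 h2; apply: h.
rewrite (negbTE hnf) in hev hun eQ.
have edec : nl (elit (Entry (v, false) (level P).+1 None)) = (d, j, false) by [].
have eqT : eq_asg (P ++ Q) (asgT g j c) (asgF g f j c m).
  split=> i y; rewrite eQ ?e1 ?e2.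
    by rewrite !andbF orbF /preT (negbTE hnf).
  rewrite andbT /preF (negbTE hnf) /=.
  have [ey|hyj] := eqVneq y j; last by rewrite /asgF ?(negbTE hnf); arith.
  subst y; rewrite andbT.
  have [ed|hid] := eqVneq i d; first by subst i; rewrite /asgF ?(negbTE hnf); arith.
  have hlast := @dc_last hdc i; have hFi := hfF i.
  have [hid'|hid'] := ltnP i d; last first.
    have him : m <= i \/ i = j 
      by have [h|h] := leqP m i; [left|right; apply: hlast => //; rewrite ltn_neqAle eq_sym hid].
    rewrite /asgF ?(negbTE hnf); arith.
  move: (hFi hid'); rewrite /preF (negbTE hnf) /= /asgF ?(negbTE hnf) /=.
  have [eij|hij] := eqVneq i j; first by subst i; arith.
  by move=> /(_ isT); arith.
exists (P ++ Q), [::]; split=> //.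
- split=> //.
  + have hbase := @base_single (P ++ Q) P Q (erefl _); apply: hbase.
      by move=> e /(allP hlev); rewrite hl ltnS.
    move=> i him hij hid; have : (i, j, false) \in nls (P ++ Q).
      by rewrite (proj2 eqT) /asgF eqxx him hij.
    by rewrite eQ (negbTE hid) orbF.
  + exists d, (Entry (v, false) (level P).+1 None).
    by split; [exact: hd|rewrite mem_cat mem_head orbT|exact: edec|rewrite hl].
  + by rewrite hl.
  + by rewrite cats0.
- by rewrite cats0.
- by rewrite size_cat addn1.
- move=> e; rewrite drop_size_cat // inE => /eqP ->; exists d; split=> //; arith.
Qed.

Lemma stage0_sub P Q : stage0 P Q -> sub_asg (P ++ Q) (asgT g j c) (asgF g f j c m).
Proof.
move=> [dec [T2 [-> [hdec hff] [e1 e2] _ hT2]]].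
rewrite -cat_rcons; split=> i y; rewrite nls_cat mem_cat ?e1 ?e2 => /orP[].
- by [].
- by case: hT2 => [->|[e [-> [hn _ _]]]] //; rewrite inE hn !xpair_eqE andbF.
- by case/andP.
- case: hT2 => [->|[e [-> [hn _ _]]]] //; rewrite inE hn => /eqP[-> ->].
  by rewrite /asgF; arith.
Qed.

Lemma stage0_grow P Q C l :
  stage0 P Q -> C \in db -> unit_at (P ++ Q) C l ->
  (exists e Q', Q = e :: Q' /\ neg (elit e) \in C) \/ C = [set l] ->
  stage0 P (rcons Q (Entry l (level (P ++ Q)) (Some C))).
Proof.
move=> h0 hC hu hhd; have [sT sF] := stage0_sub h0.
case: h0 => dec [T2 [EQ [hdec hff] [e1 e2] [hlev hld hrd] hT2]].
have hg := hfg hff; have hcc := hc hg.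
have hjc : (j, c, true) \in nls (P ++ Q).
  by rewrite EQ -cat_rcons nls_cat mem_cat e1 /asgT hg !eqxx.
have hdc' : (d, c, false) \in nls (P ++ Q).
  by rewrite EQ nls_cat mem_cat in_cons hdec eqxx orbT.
have hun := proj1 (andP (proj2 (andP hu))).
have [un1 un2] := (unassigned_nl true hun, unassigned_nl false hun).
case: hhd => [[e [Q' [EQ' he]]]|hsing]; last first.
  by exfalso; apply: (not_singleton hdb hcf hC hu _ hsing).
have hneg : nl (neg (elit e)) = (d, c, true).
  by move: EQ'; rewrite EQ => -[<- _]; rewrite nl_neg hdec.
have hl : nl l = (d, j, false).
  move: (unit_casesP hdb hC hu) un1 un2; case E' : _ / => [i y k hA hk h1 h2|i y k hA hk h1 h2|i y k hA hk h1 h2|i y hB hk h1|i y k hK EC hi h1] /=;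
    rewrite ?E' /= => un1 un2.
  - move: he; rewrite hA hneg !inE => /or3P[/eqP //|/eqP //|/eqP [ei ek]]; subst i k.
    by have /and3P[_ /eqP -> _] := sT _ _ h1.
  - move: he; rewrite hA hneg !inE => /or3P[/eqP //|/eqP //|/eqP [ei ek]]; subst i k.
    by have /and3P[_ /eqP ej _] := sT _ _ h1; arith.
  - move: he; rewrite hA hneg !inE => /or3P[/eqP //|/eqP //|/eqP [ei ek]]; subst i k.
    by rewrite hdc' in un2.
  - by move: he; rewrite hB hneg !inE => /orP[] /eqP.
  - move: he; rewrite EC in_colC hneg /= => /and3P[/eqP ey _ _]; subst y.
    have hjk := cf_shadow hcf hg hK.
    have [ei|hij] := eqVneq i j; first by subst i; rewrite hjc in un1.
    have hjc' : j != c by arith.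
    have hji : j != i by arith.
    by have := sF _ _ (h1 j hjk hjc' hji); rewrite /asgF; arith.
have ET2 : T2 = [::].
  case: hT2 => // -[e' [ET [hn _ _]]]; move: un2; rewrite hl.
  by rewrite EQ ET nls_cat mem_cat !in_cons hn eqxx !orbT.
exists dec, [:: Entry l (level (P ++ Q)) (Some C)]; split=> //; first by rewrite EQ ET2.
right; exists (Entry l (level (P ++ Q)) (Some C)); split=> //; split=> //.
by rewrite EQ ET2 /= level_cat /level /= hrd !addn1.
Qed.

Lemma stage0_dequeue P e Q :
  uniq (tvars (P ++ e :: Q)) -> stage0 P (e :: Q) ->
  settled F L (rcons P e) (P ++ e :: Q) ->
  @stage1 N g f j c m tgt (rcons P e) Q.
Proof.
move=> hu h0 hs; have [sT sF] := stage0_sub h0.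
case: h0 => dec [T2 [[? ?] [hdec hff] [e1 e2] [hlev hld hrd] hT2]]; subst dec T2.
have hg := hfg hff; have hcc := hc hg; have hdc' := hdcc hg.
have hsub : {subset nls (rcons P e) <= nls (P ++ e :: Q)}.
  by move=> t ht; rewrite -cat_rcons nls_cat mem_cat ht.
have [e' [EQ [hn hr hle]]] : exists e', Q = [:: e'] /\ [/\ nl (elit e') = (d, j, false),
    ereason e' <> None & elevel e' = (level P).+1].
  case: hT2 => // EQ; exfalso.
  have h1 : (j, c, true) \in nls (rcons P e) by rewrite e1 /asgT hg !eqxx.
  have h2 : (d, c, false) \in nls (rcons P e).
    by rewrite /nls map_rcons mem_rcons -hdec mem_head.
  case: (forcedA (i := d) hdb hs hsub h1 h2); try arith.
    by move/sT; rewrite /asgT; arith.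
  by rewrite EQ cats1 e2 !eqxx andbF.
have hl : level (P ++ [:: e; e']) = (level P).+1.
  rewrite level_cat /level /= hrd; case: (ereason e') hr => //= _ _.
  by rewrite !addn0 addn1.
rewrite EQ in hu *.
have eqT : eq_asg (P ++ [:: e; e']) (asgT g j c) (asgF g f j c m).
  rewrite -cat_rcons; split=> i y; rewrite nls_cat mem_cat ?e1 ?e2 inE hn !xpair_eqE /=.
    by rewrite andbF orbF.
  rewrite andbT; have [->|hid] := eqVneq i d; last by rewrite andbT orbF.
  by have [->|hyj] := eqVneq y j; rewrite ?andbT ?orbF //= /asgF; arith.
exists (P ++ [:: e; e']), [::]; split=> //.
- split=> //.
  + have hbase := @base_single (P ++ [:: e; e']) P [:: e; e'] (erefl _); apply: hbase.
      by move=> a /(allP hlev); rewrite hl ltnS.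
    move=> i him hij hid; have : (i, j, false) \in nls (P ++ [:: e; e']).
      by rewrite (proj2 eqT) /asgF eqxx him hij.
    rewrite nls_cat mem_cat !inE hn hdec !xpair_eqE (negbTE hid) /=.
    by rewrite !orbF.
  + exists d, e'.
    by split; [exact: hd|rewrite mem_cat !inE eqxx !orbT|exact: hn|rewrite hl hle].
  + by rewrite hl.
  + by rewrite cats0.
- by rewrite cats0 cat_rcons.
- by rewrite size_rcons size_cat addn2.
- move=> a; rewrite -cat_rcons drop_size_cat // inE => /eqP ->; exists d; split=> //; arith.
Qed.

Lemma stage0_consistent P Q C :
  stage0 P Q -> C \in db ->
  (forall T C, sub_asg T (confT g j c m) (confF g f j c m) -> C \in db -> falsified T C ->
     exists2 b, b < m & (b, m, false) \in nls T) ->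
  ~~ falsified (P ++ Q) C.
Proof.
move=> /stage0_sub [sT sF] hC hfal; apply/negP => hf.
have hsub : sub_asg (P ++ Q) (confT g j c m) (confF g f j c m).
  by split=> i y => [/sT|/sF] h; rewrite /confT /confF h.
have [b hb] := hfal _ _ hsub hC hf.
by move/sF; have := hfg; rewrite /asgF; arith.
Qed.

Variable S : trail var -> trail var -> Prop.
Hypothesis hst : stable F L S tgt.
Hypothesis hS : forall P Q, @stage1 N g f j c m tgt P Q -> S P Q.
Hypothesis hfal : forall T C, sub_asg T (confT g j c m) (confF g f j c m) ->
  C \in db -> falsified T C -> exists2 b, b < m & (b, m, false) \in nls T.
Hypothesis hvars : forall i y, i <= N -> y <= N -> i != y -> (inord i, inord y) \in vars.

Definition phase_inv P Q := [\/ exists b, pre b P Q, stage0 P Q | S P Q].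

Lemma phase_init : phase_inv [::] [::].
Proof. by constructor 1; exists 0. Qed.

Lemma last_unassigned b P Q s : pre b P Q -> (d, x, s) \notin nls (P ++ Q).
Proof.
case=> [[sT sF] _ hb]; apply/negP; case: s => [/sT|/sF]; rewrite /preT /preF /asgT /asgF.
  case: (f) hjd hfg => h1 h2; arith.
case: (f) hjd hfg => h1 h2; arith.
Qed.

Lemma phase_step P Q s :
  wf F L P Q -> phase_inv P Q -> cdcl_step delta F vars (Search L P Q) s ->
  (exists P' Q', s = Search L P' Q' /\ phase_inv P' Q') \/
  s = Search (rcons L tgt) [::] [::].
Proof.
move=> hwf hinv /stepE hstep.
have hcons C : C \in db -> falsified (P ++ Q) C -> S P Q.
  case: hinv => [[b hp]|h0|//] hC hf.
    by case/negP: (pre_consistent (pr_b hp) (pr_sub hp) hC).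
  by case/negP: (stage0_consistent h0 hC hfal).
case: hstep hwf hinv => [C l hC hu hhd|e Q' EQ hs|v EQ hs hv|C hC hf hl|C hC hf hl|EQ hs hall] hwf hinv.
- left; exists P, (rcons Q (Entry l (level (P ++ Q)) (Some C))); split=> //.
  case: hinv => [[b hp]|h0|h]; [constructor 1|constructor 2|constructor 3].
  + have := pre_unit (pr_b hp) (pr_sub hp) hC hu => hl; have [h1 h2 h3] := hp.
    exists b; split=> //; rewrite -rcons_cat.
      by apply: sub_asg_rcons => // i y /= E; move: hl; rewrite E.
    move=> i hi hix hij; have := h2 i hi hix hij.
    by rewrite /nls map_rcons mem_rcons in_cons => ->; rewrite orbT.
  + exact: stage0_grow.
  + exact: (st_grow hst).
- subst Q; left; exists (rcons P e), Q'; split=> //.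
  case: hinv => [[b hp]|h0|h].
  + constructor 1; exists b; case: hp => h1 h2 h3.
    by split=> //; rewrite cat_rcons.
  + by constructor 3; apply: hS; apply: stage0_dequeue h0 hs; exact: wf_uniq hwf.
  + by constructor 3; apply: (st_dequeue hst).
- subst Q; left; exists P, [:: Entry (v, false) (level P).+1 None]; split=> //.
  case: hinv => [[b hp]|[? [? [//]]]|/(st_queue hst) //].
  have := pre_decide hwf hp hs hv; case=> [h|h|/hS h];
    by [constructor 1|constructor 2|constructor 3].
- by right; have [-> _] := st_learn hst (hcons _ hC hf) hC hf.
- by exfalso; have [_] := st_learn hst (hcons _ hC hf) hC hf; rewrite hl.
- subst Q; exfalso; case: hinv => [[b hp]|[? [? [//]]]|/(st_queue hst) //].
  have hd1 : d <= N by move: (hd) (hjm); clear; arith.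
  have hx1 : x <= N by move: (hjm) (hc) (hfg); clear; case: f => /= *; arith.
  have hdx : d != x by move: (hd) (hdcc) (hfg); clear; case: f => /= *; arith.
  have := allP hall _ (hvars hd1 hx1 hdx).
  move=> /(@assigned_nls _ P (mk N d x true) d x true (nl_mk _ hd1 hx1)).
  by have := last_unassigned _ hp; rewrite cats0 => h [/(negP (h true))|/(negP (h false))].
Qed.

End Phase.

(** * Scores and the variables of the ordering principle *)

Section Vsids.

Local Open Scope ring_scope.
Variables (V : finType) (R : realFieldType) (delta : R).
Hypotheses (d0 : 0 < delta) (d2 : delta <= 2%:R^-1).
Implicit Types (L : seq (clause V)) (x y : V).

Local Notation q := (vsids delta).

Lemma vsids_rcons L C x : q (rcons L C) x = (occurs x C)%:R + delta * q L x.
Proof. by rewrite /vsids -cats1 foldl_cat. Qed.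

Lemma vsids_bound L x : 0 <= q L x < 2.
Proof.
elim/last_ind: L => [|L C /andP[h1 h2]]; first by rewrite /vsids /= lexx ltr0n.
rewrite vsids_rcons; apply/andP; split.
  by rewrite addr_ge0 ?ler0n // mulr_ge0 // ltW.
have h3 : delta * q L x < 1.
  apply: (@le_lt_trans _ _ (2^-1 * q L x)); first by rewrite ler_wpM2r.
  by rewrite mulrC ltr_pdivrMr ?ltr0n // mul1r.
have h4 : (occurs x C)%:R <= 1 :> R by rewrite lern1 leq_b1.
by rewrite -[2]/(1 + 1); apply: ler_ltD.
Qed.

Lemma vsids_mono L x y :
  (forall C, C \in L -> occurs y C -> occurs x C) -> q L y <= q L x.
Proof.
elim/last_ind: L => [|L C IH] h; first by rewrite /vsids.
rewrite !vsids_rcons lerD //.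
  have := h C; rewrite mem_rcons mem_head => /(_ isT).
  by rewrite ler_nat; case: occurs => // ->.
rewrite ler_pM2l //; apply: IH => C' hC'; apply: h.
by rewrite mem_rcons in_cons hC' orbT.
Qed.

(* As [delta <= 1/2], one recent occurrence outweighs all earlier ones. *)
Lemma vsids_recent L1 L2 x y :
  has (occurs x) L2 -> ~~ has (occurs y) L2 -> q (L1 ++ L2) y < q (L1 ++ L2) x.
Proof.
elim/last_ind: L2 => [//|L2 C IH]; rewrite !has_rcons -rcons_cat !vsids_rcons negb_or.
move=> hx /andP[/negbTE -> hy]; rewrite add0r.
have [hxC|hxC] := boolP (occurs x C); last first.
  by rewrite add0r ltr_pM2l // IH //; move: hx; rewrite (negbTE hxC).
have /andP[h1 h2] := vsids_bound (L1 ++ L2) y; have /andP[h3 _] := vsids_bound (L1 ++ L2) x.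
apply: (@lt_le_trans _ _ 1); last by rewrite lerDl mulr_ge0 // ltW.
apply: (@le_lt_trans _ _ (2^-1 * q (L1 ++ L2) y)); first by rewrite ler_wpM2r.
by rewrite mulrC ltr_pdivrMr ?ltr0n // mul1r.
Qed.

End Vsids.

Section Variables_order.

Variable N : nat.
Local Notation var := (op_var N.+1).
Implicit Types (x y z : var).

Definition ltv x y := ((x.2 : nat) < y.2) || ((x.2 : nat) == y.2) && ((x.1 : nat) < y.1).

Lemma ltv_trans : transitive ltv.
Proof. by move=> y x z; rewrite /ltv; lia. Qed.

Lemma ltv_irr : irreflexive ltv.
Proof. by move=> x; rewrite /ltv; lia. Qed.

Lemma enum_lt : pairwise (fun i i' : 'I_N.+1 => (i : nat) < i') (enum 'I_N.+1).
Proof.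
have := iota_ltn_sorted 0 N.+1.
by rewrite (sorted_pairwise ltn_trans) -val_enum_ord pairwise_map.
Qed.

Lemma op_vars_sorted : sorted ltv (op_vars N.+1).
Proof.
apply: sorted_filter; first exact: ltv_trans.
rewrite (sorted_pairwise ltv_trans).
have h : forall s t : seq 'I_N.+1, pairwise (fun i i' : 'I_N.+1 => (i : nat) < i') s ->
    pairwise (fun i i' : 'I_N.+1 => (i : nat) < i') t ->
    pairwise ltv [seq (i, j) | j <- s, i <- t].
  elim=> // a s IH t; rewrite pairwise_cons => /andP[ha hs] ht.
  rewrite allpairs_cons pairwise_cat IH // andbT; apply/andP; split.
    apply/allrelP => x y /mapP[i _ ->] /allpairsP[[j i'] /= [hj _ ->]].
    by rewrite /ltv /= (allP ha _ hj).
  rewrite pairwise_map; apply: sub_pairwise ht => i i' hi.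
  by rewrite /ltv /= eqxx hi orbT.
exact: h enum_lt enum_lt.
Qed.

Lemma mem_op_vars x : (x \in op_vars N.+1) = (x.1 != x.2).
Proof.
rewrite mem_filter andb_idr // => _; apply/allpairsP; exists (x.2, x.1).
by rewrite !mem_enum; case: x.
Qed.

Lemma index_ltv x y : x \in op_vars N.+1 -> y \in op_vars N.+1 -> ltv x y ->
  index x (op_vars N.+1) < index y (op_vars N.+1).
Proof.
move=> hx hy hxy; rewrite ltnNge leq_eqVlt; apply/negP => /orP[/eqP E|h].
  have E' : y = x by rewrite -(nth_index x hx) -(nth_index x hy) E.
  by move: hxy; rewrite E' ltv_irr.
have := sorted_ltn_index ltv_trans op_vars_sorted _ _ hy hx h.
by move=> /(ltv_trans hxy); rewrite ltv_irr.
Qed.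

Lemma column_eq (y : nat) : y <= N ->
  column N.+1 y.+1 = [seq (i, inord y) | i : 'I_N.+1 <- enum 'I_N.+1 & (i : nat) != y].
Proof.
move=> hy; apply: (irr_sorted_eq ltv_trans ltv_irr).
- by apply: sorted_filter; [exact: ltv_trans|exact: op_vars_sorted].
- rewrite (sorted_pairwise ltv_trans) pairwise_map; apply: pairwise_filter.
  apply: sub_pairwise enum_lt => i i' hi.
  by rewrite /ltv /= eqxx hi orbT.
move=> x; rewrite mem_filter mem_op_vars eqSS; apply/andP/mapP => [[h1 h2]|[i]].
  exists x.1; first by rewrite mem_filter mem_enum andbT -(eqP h1).
  by rewrite [LHS]surjective_pairing; congr pair; apply/val_inj; rewrite /= inordK // (eqP h1).
rewrite mem_filter => /andP[hi _] -> /=; rewrite inordK // eqxx; split=> //.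
by apply: contra hi => /eqP ->; rewrite /= inordK.
Qed.

Lemma clauseC_colC (y k : nat) : y <= k <= N -> clauseC N.+1 y.+1 k = colC N y k.
Proof.
case/andP=> hyk hkN; have hyN := leq_trans hyk hkN.
have hv : map val (take k [seq i : 'I_N.+1 <- enum 'I_N.+1 | (i : nat) != y])
        = [seq i <- iota 0 k.+1 | i != y].
  rewrite map_take -(filter_map _ (fun i => i != y)) val_enum_ord.
  have -> : N.+1 = k.+1 + (N - k) by lia.
  rewrite iotaD filter_cat take_size_cat // size_filter.
  have := count_predC (pred1 y) (iota 0 k.+1); rewrite size_iota.
  have -> : count (pred1 y) (iota 0 k.+1) = 1.
    by rewrite count_uniq_mem ?iota_uniq // mem_iota; lia.
  by rewrite add1n => -[].
apply/setP => l; rewrite in_colC; apply/imsetP/idP => [[x hx ->]|].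
  move: hx; rewrite column_eq // -map_take => /mapP[i hi ->] /=.
  have : val i \in map val (take k [seq i : 'I_N.+1 <- enum 'I_N.+1 | (i : nat) != y]) by apply: map_f.
  rewrite hv mem_filter mem_iota inordK // eqxx /=; lia.
case: l => [[i y'] s] /= /and4P[hs /eqP hy' hi hk]; exists (i, y'); last by rewrite hs.
rewrite column_eq // -map_take; apply/mapP; exists i.
  by rewrite -(mem_map val_inj) hv mem_filter mem_iota /= hi add0n ltnS.
by congr pair; apply/val_inj; rewrite /= inordK.
Qed.

Definition clauses_of (ps : seq (nat * nat)) := [seq colC N p.1 p.2 | p <- ps].

Lemma occurs_colC x (y k : nat) : occurs x (colC N y k) =
  [&& (x.2 : nat) == y, (x.1 : nat) != y & x.1 <= k].
Proof. by rewrite /occurs !in_colC /= orbF. Qed.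

Definition known (ps : seq (nat * nat)) (y k : nat) := (k == N) && (y <= N) || ((y, k) \in ps).

Lemma op_db_spec ps : all (fun p => p.1 <= p.2 <= N) ps ->
  db_spec (OP N.+1) (clauses_of ps) (known ps).
Proof.
move=> hps.
have AisA (i j k : 'I_N.+1) : isA (clauseA i j k) i j k.
  move=> l; rewrite !inE /nl; case: l => [[a b] s].
  by rewrite /Defs.negP /posP !xpair_eqE /= -!(inj_eq val_inj) /= ?orbA.
have BisB (i j : 'I_N.+1) : isB (clauseB i j) i j.
  move=> l; rewrite !inE /nl; case: l => [[a b] s].
  by rewrite /Defs.negP /posP !xpair_eqE /= -!(inj_eq val_inj) /= ?orbA.
have DisC (j : 'I_N.+1) : clauseD j = colC N j N.
  apply/setP => l; rewrite in_colC; apply/imsetP/idP => [[i hi ->]|].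
    by move: hi; rewrite inE -(inj_eq val_inj) /= => ->; rewrite eqxx leq_ord.
  case: l => [[i y] s] /= /and4P[-> /eqP hy hi _]; exists i.
    by rewrite inE -(inj_eq val_inj).
  by have -> : y = j by apply/val_inj.
split.
- move=> C; rewrite inE => /orP[|].
    rewrite !inE -orbA => /or3P[/existsP[i /existsP[j /existsP[k /and4P[h1 h2 h3 /eqP ->]]]]|
      /existsP[i /existsP[j /andP[h1 /eqP ->]]]|/imsetP[j _ ->]].
    + constructor 1; exists (i : nat), (j : nat), (k : nat); split=> //; move: h1 h2 h3.
      rewrite -!(inj_eq val_inj) /= => -> -> ->.
      by rewrite !leq_ord.
    + constructor 2; exists (i : nat), (j : nat); split=> //; move: h1.
      by rewrite -!(inj_eq val_inj) /= => ->; rewrite !leq_ord.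
    + by constructor 3; exists (j : nat), N; rewrite DisC /known eqxx leq_ord.
  rewrite inE => /mapP[[y k] hp ->]; constructor 3; exists y, k.
  by rewrite /known hp orbT.
- move=> i j k h; exists (clauseA (inord i) (inord j) (inord k)).
    rewrite !inE; apply/orP; left; apply/orP; left; apply/orP; left.
    apply/existsP; exists (inord i); apply/existsP; exists (inord j).
    apply/existsP; exists (inord k).
    rewrite eqxx -!(inj_eq val_inj) /= !inordK; lia.
  by have := AisA (inord i) (inord j) (inord k); rewrite !inordK; (lia || apply).
- move=> i j h; exists (clauseB (inord i) (inord j)).
    rewrite !inE; apply/orP; left; apply/orP; left; apply/orP; right.
    apply/existsP; exists (inord i); apply/existsP; exists (inord j).
    rewrite eqxx -!(inj_eq val_inj) /= !inordK; lia.
  by have := BisB (inord i) (inord j); rewrite !inordK; (lia || apply).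
- move=> y k; rewrite /known => /orP[/andP[/eqP -> hy]|hp]; rewrite inE; apply/orP.
    left; rewrite inE; apply/orP; right; apply/imsetP; exists (inord y) => //.
    by rewrite DisC inordK.
  by right; rewrite inE; apply/mapP; exists (y, k).
- move=> y k; rewrite /known => /orP[/andP[/eqP -> hy]|/(allP hps) //].
  by rewrite hy leqnn.
Qed.

Section Choice.

Variables (R : realFieldType) (delta : R).
Hypotheses (d0 : (0 < delta)%R) (d2 : (delta <= 2%:R^-1)%R).

(* Ties in column [x] are broken in favour of small rows, which also occur in
   more clauses. *)
Lemma vsids_column ps1 ps2 (x d : nat) (P : trail var) v :
  x <= N -> d <= N -> d != x ->
  all (fun p => p.1 == x) ps2 ->
  (ps1 ++ ps2 == [::]) && (x == 0) || has (fun p => d <= p.2) ps2 ->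
  vsids_choice delta (op_vars N.+1) (clauses_of (ps1 ++ ps2)) P v ->
  (forall s, (d, x, s) \notin nls P) ->
  exists i, [/\ (i <= d) && (i != x), v = (inord i, inord x)
      & forall a, a < i -> a != x -> exists s, (a, x, s) \in nls P].
Proof.
move=> hx hd hdx hcol hocc /and3P[hv huv /allP hall] hun.
have free a s : unassigned P (inord a : 'I_N.+1, inord x : 'I_N.+1) ->
    a <= N -> (a, x, s) \notin nls P.
  move=> h ha; have := unassigned_nl (l := mk N a x true) s h.
  by rewrite nl_mk //= => ->.
have taken a : a <= N -> ~~ unassigned P (inord a : 'I_N.+1, inord x : 'I_N.+1) ->
    exists s, (a, x, s) \in nls P.
  move=> ha h; have [h'|h'] := @assigned_nls _ P (mk N a x true) a x true (nl_mk _ ha hx) h.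
    by exists true.
  by exists false.
pose p a := [&& a <= N, a != x & unassigned P (inord a : 'I_N.+1, inord x : 'I_N.+1)].
have pd : p d.
  rewrite /p hd hdx /=.
  case: (boolP (unassigned P (inord d : 'I_N.+1, inord x : 'I_N.+1))) => // h.
  by have [s] := taken d hd h; rewrite (negbTE (hun s)).
have [i /and3P[hi hix hiu] himin] := ex_minnP (ex_intro p d pd).
have hid := himin d pd.
pose z : var := (inord i, inord x).
have hz : z \in op_vars N.+1.
  by rewrite mem_op_vars /z /= -(inj_eq val_inj) /= !inordK.
have hord : ltv z v -> ~~ (index v (op_vars N.+1) <= index z (op_vars N.+1)).
  by move=> h; rewrite -ltnNge; apply: index_ltv.
have := hall z hz; rewrite hiu /= => hbest.
exists i; split; first by rewrite hid hix.
  have hv' : (v.1 : nat) != v.2 by move: hv; rewrite mem_op_vars -(inj_eq val_inj).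
  have [ey|hyx] := eqVneq (v.2 : nat) x; last first.
    exfalso; case/orP: hocc => [/andP[/eqP E /eqP ex]|hocc].
      move: hbest; rewrite E /vsids /= ltxx eqxx /= => hle.
      have hzv : ltv z v by rewrite /ltv /z /= !inordK // ltn_neqAle eq_sym hyx {1}ex.
      by have := hord hzv; rewrite hle.
    have hlt : (vsids delta (clauses_of (ps1 ++ ps2)) v
                < vsids delta (clauses_of (ps1 ++ ps2)) z)%R.
      rewrite /clauses_of map_cat; apply: vsids_recent => //.
        have [p' hp' hdp] := hasP hocc; rewrite has_map; apply/hasP; exists p' => //=.
        rewrite occurs_colC /z /= !inordK // (eqP (allP hcol _ hp')) eqxx hix /=.
        exact: leq_trans hid hdp.
      rewrite has_map; apply/hasPn => p' hp' /=.
      by rewrite occurs_colC (eqP (allP hcol _ hp')) (negbTE hyx).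
    by move: hbest; rewrite ltNge (ltW hlt) /= (gt_eqF hlt).
  have hiv : i <= v.1.
    apply: himin; rewrite /p -ltnS ltn_ord -{1}ey hv' /=.
    have -> : (inord v.1, inord x) = v; last by [].
    rewrite [RHS]surjective_pairing inord_val; congr pair.
    by apply/val_inj; rewrite /= inordK.
  have hle : (vsids delta (clauses_of (ps1 ++ ps2)) v
                <= vsids delta (clauses_of (ps1 ++ ps2)) z)%R.
    apply: vsids_mono => // C /mapP[p' _ ->]; rewrite !occurs_colC /z /= !inordK //.
    by case/and3P=> /eqP <- _ hk; rewrite ey eqxx hix (leq_trans hiv hk).
  have [ei|hne] := eqVneq i (v.1 : nat).
    by rewrite [v]surjective_pairing; congr pair; apply/val_inj; rewrite /= inordK.
  have : ltv z v by rewrite /ltv /z /= !inordK // ey eqxx ltnn ltn_neqAle hne.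
  move/hord/negbTE => h; by move: hbest; rewrite h andbF orbF ltNge hle.
have haN a : a < i -> a <= N by move=> h; apply: leq_trans (ltnW h) hi.
move=> a ha hax; apply: taken; first exact: haN.
apply/negP => hu; have := himin a.
by rewrite /p hax hu haN // => /(_ isT); rewrite leqNgt ha.
Qed.

End Choice.
End Variables_order.

Section Downto.

Lemma mem_downto a b x : (x \in downto a b) = (b <= x <= a).
Proof. by rewrite mem_rev mem_iota; lia. Qed.

Lemma downto_rcons a b : b <= a -> downto a b = rcons (downto a b.+1) b.
Proof.
by move=> h; rewrite /downto -rev_cons subSS (subSn h).
Qed.

Lemma downto_nil a : downto a a.+1 = [::].
Proof. by rewrite /downto subnn. Qed.

Lemma downto_succ a b : downto a.+1 b.+1 = map S (downto a b).
Proof. by rewrite /downto map_rev subSS -[b.+1]addn1 addnC iotaDl. Qed.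

End Downto.

(** * The sequence of learned clauses *)

Section Schedule.

Variable N : nat.
Hypothesis hN : 5 <= N.
Local Notation var := (op_var N.+1).

(* In phase [Ph q k] the solver is about to learn [colC q k]; [H0] and [H1] are
   the phases of the two head_pairs clauses, and the phase [Ph 0 1] refutes. *)
Variant phase := H0 | H1 | Ph of nat & nat.

Definition top_index q := if q == 0 then N - 3 else N - 1.
Definition block y := [seq (y, k) | k <- downto (N - 1) y].
Definition cascade q := flatten [seq block y | y <- downto (N - 2) q.+1].
Definition head_pairs := [:: (0, N - 1); (0, N - 2)].

Definition learned ph := match ph with
  | H0 => [::]
  | H1 => [:: (0, N - 1)]
  | Ph q k => (head_pairs ++ cascade q) ++ [seq (q, i) | i <- downto (top_index q) k.+1]
  end.

Definition target ph := match ph with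
  | H0 => (0, N - 1)
  | H1 => (0, N - 2)
  | Ph q k => (q, k)
  end.

Definition next_phase ph := match ph with
  | H0 => H1
  | H1 => Ph (N - 2) (N - 1)
  | Ph q k => if (0 < q) && (k == q) then Ph q.-1 (top_index q.-1) else Ph q k.-1
  end.

Definition terminal ph := if ph is Ph 0 1 then true else false.

Definition valid ph := if ph is Ph q k then
  [&& q <= N - 2, q <= k, 0 < k & k <= top_index q] else true.

Definition remaining ph := match ph with
  | H0 => (N * N).+1 | H1 => N * N | Ph q k => q * N + k end.

Lemma top0 : top_index 0 = N - 3. Proof. by []. Qed.
Lemma topS q : 0 < q -> top_index q = N - 1. Proof. by case: q. Qed.

Lemma terminalE q k : terminal (Ph q k) = (q == 0) && (k == 1).
Proof. by case: q k => [|q] [|[|k]]. Qed.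

Lemma valid_next ph : valid ph -> ~~ terminal ph ->
  valid (next_phase ph) /\ remaining (next_phase ph) < remaining ph.
Proof.
case: ph => [||q k] //=; first by move=> _ _; rewrite topS; nia.
rewrite -/(terminal (Ph q k)) terminalE => /and4P[h1 h2 h3 h4] ht.
case: ifP => [/andP[hq /eqP ek]|hk] /=.
  have hle : 0 < top_index q.-1 <= N - 1 by rewrite /top_index; case: ifP => _; lia.
  have hq1 : q.-1 <= top_index q.-1 by rewrite /top_index; case: ifP => /eqP h; lia.
  split; first by rewrite leqnn; lia.
  by case: q hq {h1 h2 h4 ht ek hq1} hle => // q _; rewrite mulSn /=; nia.
split; last by case: (k) h3 => // k' _; rewrite addnS.
have [hq|hq] := posnP q; first by subst q; rewrite top0 in h4 *; lia.
by rewrite topS // in h4 *; lia.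
Qed.

Lemma cascade_step q : 0 < q <= N - 2 -> cascade q.-1 = cascade q ++ block q.
Proof.
case: q => // q /= hq; rewrite /cascade [downto _ q.+1]downto_rcons //.
by rewrite map_rcons flatten_rcons.
Qed.

Lemma learned_next ph : valid ph -> ~~ terminal ph ->
  learned (next_phase ph) = rcons (learned ph) (target ph).
Proof.
case: ph => [//||q k].
  move=> _ _; rewrite /next_phase /learned topS; last by lia.
  rewrite downto_nil cats0.
  by have -> : cascade (N - 2) = [::] by rewrite /cascade downto_nil.
rewrite terminalE => /and4P[h1 h2 h3 h4] ht; rewrite /next_phase.
case: ifP => [/andP[hq /eqP ek]|hk]; rewrite /learned /target.
  rewrite downto_nil cats0 cascade_step ?hq // catA rcons_cat; congr cat.
  by rewrite topS // ek /block downto_rcons ?map_rcons //; lia.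
rewrite rcons_cat; congr cat; case: k h2 h3 h4 ht hk => // k h2 h3 h4 ht hk.
by rewrite -map_rcons /= -downto_rcons.
Qed.

Lemma mem_block y z k : ((z, k) \in block y) = (z == y) && (y <= k <= N - 1).
Proof.
apply/mapP/andP => [[i]|[/eqP -> h]]; last by exists k; rewrite ?mem_downto.
by rewrite mem_downto => h [-> ->].
Qed.

Lemma mem_cascade q y k : ((y, k) \in cascade q) = (q < y <= N - 2) && (y <= k <= N - 1).
Proof.
apply/flatten_mapP/andP => [[z]|[h1 h2]].
  by rewrite mem_downto mem_block => h /andP[/eqP -> h'].
by exists y; rewrite ?mem_downto // mem_block eqxx.
Qed.

Lemma known_Ph q k y i : known N (learned (Ph q k)) y i =
  [|| (i == N) && (y <= N), (y == 0) && ((i == N - 1) || (i == N - 2)),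
      (q < y <= N - 2) && (y <= i <= N - 1) | (y == q) && (k < i <= top_index q)].
Proof.
have hlast : ((y, i) \in [seq (q, z) | z <- downto (top_index q) k.+1]) =
    (y == q) && (k < i <= top_index q).
  apply/mapP/andP => [[z]|[/eqP -> h]]; last by exists i; rewrite ?mem_downto.
  by rewrite mem_downto => h [-> ->].
rewrite /known /learned mem_cat hlast mem_cat mem_cascade !inE !xpair_eqE.
by rewrite -andb_orr -!orbA.
Qed.

Lemma known_H0 y i : known N (learned H0) y i = (i == N) && (y <= N).
Proof. by rewrite /known orbF. Qed.

Lemma known_H1 y i :
  known N (learned H1) y i = (i == N) && (y <= N) || (y == 0) && (i == N - 1).
Proof. by rewrite /known inE xpair_eqE. Qed.

Lemma learned_le ph : valid ph -> all (fun p => p.1 <= p.2 <= N) (learned ph).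
Proof.
case: ph => [//|_|q k]; first by rewrite /= leq_subr.
move=> /and4P[h1 h2 h3 h4]; apply/allP => -[y i] /= hin.
have : known N (learned (Ph q k)) y i.
  by rewrite /known; apply/orP; right; exact: hin.
rewrite known_Ph; have [hq|hq] := posnP q; first by subst q; rewrite top0; lia.
by rewrite topS //; lia.
Qed.

Section Run.

Variables (R : realFieldType) (delta : R).
Hypotheses (d0 : (0 < delta)%R) (d2 : (delta <= 2%:R^-1)%R).

Local Notation F := (OP N.+1).
Local Notation vars := (op_vars N.+1).
Local Notation step := (cdcl_step delta F vars).

Definition advances L K (P Q : trail var) := exists I : trail var -> trail var -> Prop,
  I P Q /\ forall P Q s, wf F L P Q -> I P Q -> step (Search L P Q) s ->
    (exists P' Q', s = Search L P' Q' /\ I P' Q') \/ s = Search (rcons L K) [::] [::].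

Lemma op_vars_all i y : i <= N -> y <= N -> i != y -> (inord i, inord y) \in vars.
Proof. by move=> hi hy h; rewrite mem_op_vars /= -(inj_eq val_inj) /= !inordK. Qed.

Lemma advances_single L KD g f j c m d k wT wF :
  k = m.-1 -> db_spec F L KD -> config N KD g f j c m -> @decisions N R delta vars L KD g f j c m d ->
  final F L KD g f j c m wT wF -> advances L (colC N j k) [::] [::].
Proof.
move=> -> hdb hcf hdc hfin; have hst := stable_single hdb (colC N j m.-1) hcf hfin.
exists (phase_inv g f j c m d (fun P Q => [\/ @stage1 N g f j c m (colC N j m.-1) P Q,
    @stage2 N g f j c m (colC N j m.-1) P Q | @stage3 N g f j c m wT wF (colC N j m.-1) P Q])).
split; first exact: phase_init.
move=> P Q s hwf hI hs.
apply: (phase_step hdb hcf hdc hst _ _ op_vars_all hwf hI hs).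
- by move=> P' Q' h; constructor 1.
- move=> T C hT hC hf; have h2m := cf_m hcf; exists 0; first lia.
  have EC := fn_falsified hfin (conf_final hfin hT) hC hf.
  have /andP[hjm hmN] := cf_jm hcf.
  have /falsified_nls h := hf; have := h (mk N 0 m true).
  rewrite EC in_colC nl_neg nl_mk //= => h'; apply: h'.
  by rewrite eqxx andbT; lia.
Qed.

Lemma advances_double L KD j m M d k wT wF :
  k = m.-1 -> M = m.+1 -> db_spec F L KD ->
  config N KD false false j j m -> config N KD true true m j M ->
  m.+1 = N -> @decisions N R delta vars L KD false false j j m d ->
  final F L KD true true m j M wT wF -> advances L (colC N j k) [::] [::].
Proof.
move=> -> -> hdb hcf hcf' hm hdc hfin.
have hst := stable_double hdb (colC N j m.-1) hcf hcf' hm hfin.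
exists (phase_inv false false j j m d (fun P Q =>
    (@stage1 N false false j j m (colC N j m.-1) P Q \/
     @stage2 N false false j j m (colC N j m.-1) P Q) \/
    [\/ @stage1 N true true m j m.+1 (colC N j m.-1) P Q,
        @stage2 N true true m j m.+1 (colC N j m.-1) P Q
      | @stage3 N true true m j m.+1 wT wF (colC N j m.-1) P Q])).
split; first exact: phase_init.
move=> P Q s hwf hI hs.
apply: (phase_step hdb hcf hdc hst _ _ op_vars_all hwf hI hs).
- by move=> P' Q' h; left; left.
- move=> T C hT hC hf; exfalso.
  by case/negP: (double_consistent hdb hcf hfin hT hC).
Qed.

Ltac by_schedule KE :=
  split; intros;
  repeat match goal with H : is_true (_ _ _) |- _ => rewrite KE in H end;
  rewrite ?KE; try lia.

Lemma advances_phase ph : valid ph -> ~~ terminal ph ->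
  advances (clauses_of N (learned ph)) (colC N (target ph).1 (target ph).2) [::] [::].
Proof.
move=> hv; have hdb := op_db_spec (learned_le hv).
have hN1 : (N - 1).+1 = N by lia.
case: ph hv hdb => [_|_|q k hv] hdb ht.
- have KE := known_H0; set KD := known N _ in hdb KE.
  have hcf : config N KD false false 0 0 N by by_schedule KE.
  apply: (advances_single (d := N - 1) _ hdb hcf); rewrite /=; first by lia.
    split=> //; try lia.
    by move=> P v; apply: (vsids_column (ps1 := [::]) (ps2 := [::]) d0 d2) => //; lia.
  by apply: (final_top hdb hcf) => [|y k]; rewrite KE; lia.
- have KE := known_H1; set KD := known N _ in hdb KE.
  have hcf : config N KD false false 0 0 (N - 1) by by_schedule KE.
  have hcf' : config N KD true true (N - 1) 0 N by by_schedule KE.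
  have hNN : KD N N by rewrite KE; lia.
  have habove y k : KD y k -> y != N ->
      [|| k == N, (y != N - 1) && (N - 1 <= k) | [&& true, y != N - 1, y != 0 & 0 <= k]].
    by rewrite KE; lia.
  apply: (advances_double (d := N - 2) _ _ hdb hcf hcf' hN1 _ (final_top hdb hcf' hNN habove));
    rewrite /=; try lia.
  split=> //; try lia.
  move=> P v; apply: (vsids_column (ps1 := [::]) (ps2 := [:: (0, N - 1)]) d0 d2) => //; try lia.
  by rewrite /= orbF; lia.
have hpart d : k < top_index q -> d <= k.+1 ->
    has (fun p => d <= p.2) [seq (q, i) | i <- downto (top_index q) k.+1].
  move=> hk hd; rewrite has_map; apply/hasP; exists k.+1 => //.
  by rewrite mem_downto leqnn.
have hcol y : all (fun p => p.1 == y) [seq (y, i) | i <- downto (top_index q) k.+1].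
  by rewrite all_map; apply/allP => i _ /=.
have hblock y : y <= N - 1 -> all (fun p => p.1 == y) (block y) /\
    has (fun p => N - 1 <= p.2) (block y).
  move=> hy; split; first by rewrite all_map; apply/allP => i _ /=.
  by rewrite has_map; apply/hasP; exists (N - 1); rewrite ?mem_downto ?hy /=.
have hend y : [seq (q, i) | i <- downto y y.+1] = [::] by rewrite downto_nil.
have KE := known_Ph q k; set KD := known N _ in hdb KE.
rewrite terminalE in ht; have [hqN hqk hk0 hk] := and4P hv.
change (advances (clauses_of N (learned (Ph q k))) (colC N q k) [::] [::]).
have [hq|hq] := posnP q.
  subst q; rewrite top0 in KE hpart hk.
  have [ek|hk'] := eqVneq k (N - 3).
    have hcf : config N KD true true 0 1 (N - 2) by by_schedule KE.
    have hNm : (N - 2).+2 <= N by lia.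
    have hmm : KD (N - 2) (N - 2) by rewrite KE; lia.
    apply: (advances_single (d := N - 3) _ hdb hcf _ (final_small hdb hcf hNm hmm)); first by lia.
    split=> //; try lia.
      by move=> _; exists 1; split=> //; [rewrite KE; lia|lia].
    have -> : learned (Ph 0 k) = (head_pairs ++ cascade 1) ++ block 1.
      rewrite /learned top0 ek hend cats0 (@cascade_step 1) -?catA //; lia.
    have [hb1 hb2] : _ /\ _ := hblock 1 ltac:(lia).
    move=> P v; apply: (vsids_column d0 d2) => //; try lia.
    by apply/orP; right; apply: sub_has hb2 => p /=; lia.
  have hcf : config N KD true false 0 1 k.+1 by by_schedule KE.
  have hNm : k.+3 <= N by lia.
  have hmm : KD k.+1 k.+1 by rewrite KE; lia.
  apply: (advances_single (d := k) _ hdb hcf _ (final_small hdb hcf hNm hmm)) => //.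
  split=> //; try lia.
    by move=> _; exists 1; split=> //; [rewrite KE; lia|lia].
  move=> P v; apply: (vsids_column d0 d2) => //; try lia.
  by rewrite hpart ?orbT //; lia.
rewrite topS // in KE hpart hcol hk.
have [ek|hk'] := eqVneq k (N - 1).
  have hNN : KD N N by rewrite KE; lia.
  have [eq|hqN'] := eqVneq q (N - 2).
    have hcf : config N KD true true q 0 N by by_schedule KE.
    have habove y i : KD y i -> y != N ->
        [|| i == N, (y != q) && (q <= i) | [&& true, y != q, y != 0 & 0 <= i]].
      by rewrite KE; lia.
    apply: (advances_single (d := N - 1) _ hdb hcf _ (final_top hdb hcf hNN habove)); first by lia.
    split=> //; try lia.
      by move=> _; exists (N - 2); split=> //; [rewrite KE; lia|lia].
    have -> : learned (Ph q k) = [::] ++ head_pairs.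
      by rewrite /learned topS // ek hend cats0 eq /cascade downto_nil.
    move=> P v; apply: (vsids_column d0 d2) => //; try lia.
    by rewrite /= leqnn.
  have hcf : config N KD true true q q.+1 N by by_schedule KE.
  have habove y i : KD y i -> y != N ->
      [|| i == N, (y != q) && (q <= i) | [&& true, y != q, y != q.+1 & q.+1 <= i]].
    by rewrite KE; lia.
  apply: (advances_single (d := N - 1) _ hdb hcf _ (final_top hdb hcf hNN habove)); first by lia.
  split=> //; try lia.
    by move=> _; exists q.+1; split=> //; [rewrite KE; lia|lia].
  have -> : learned (Ph q k) = (head_pairs ++ cascade q.+1) ++ block q.+1.
    rewrite /learned topS // ek hend cats0 -catA -cascade_step //; lia.
  have [hb1 hb2] : _ /\ _ := hblock q.+1 ltac:(lia).
  by move=> P v; apply: (vsids_column d0 d2) => //; lia.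
have hcf : config N KD false false q q k.+1 by by_schedule KE.
have hdc : @decisions N R delta vars (clauses_of N (learned (Ph q k))) KD false false q q k.+1
    (if k == q then q.-1 else k).
  split=> //; try by case: ifP => /eqP; lia.
  move=> P v; apply: (vsids_column d0 d2) => //; try by case: ifP => /eqP; lia.
  - by lia.
  - by rewrite topS.
  by rewrite topS // hpart ?orbT //; [lia|case: ifP => /eqP; lia].
have [ek|hk2] := eqVneq k (N - 2).
  have hNN : KD N N by rewrite KE; lia.
  have hcf' : config N KD true true k.+1 q N by by_schedule KE.
  have habove y i : KD y i -> y != N ->
      [|| i == N, (y != k.+1) && (k.+1 <= i) | [&& true, y != k.+1, y != q & q <= i]].
    by rewrite KE; lia.
  have hkN : k.+2 = N by lia.
  by apply: (advances_double _ _ hdb hcf hcf' hkN hdc (final_top hdb hcf' hNN habove)).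
have hNm : k.+3 <= N by lia.
have hmm : KD k.+1 k.+1 by rewrite KE; lia.
by apply: (advances_single _ hdb hcf hdc (final_small hdb hcf hNm hmm)).
Qed.

End Run.
End Schedule.

Section Main.

Variable N : nat.
Hypothesis hN : 5 <= N.
Local Notation var := (op_var N.+1).
Local Notation F := (OP N.+1).
Local Notation vars := (op_vars N.+1).
Implicit Types (P Q T : trail var).

(* With [P_{0,1}] and [P_{2,0}] known, column 2 is falsified. *)
Lemma refuted P : ~ settled F (clauses_of N (learned N (Ph 0 1))) P P.
Proof.
move=> hs; have hv : valid N (Ph 0 1) by rewrite /valid top0; lia.
have hdb := op_db_spec (learned_le hN hv); set L := clauses_of _ _ in hs hdb.
have K y k : [&& 0 < y, y <= k & k <= 2] || (y == 0) && (k == 2) ->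
    known N (learned N (Ph 0 1)) y k by rewrite known_Ph top0; lia.
have hsub : {subset nls P <= nls P} by [].
have nf C : C \in database F L -> (forall l, l \in C -> nl (neg l) \in nls P) -> False.
  move=> hC h; have [/negP h' _] := settledP _ _ _ _ hs _ hC.
  by apply: h'; apply/falsified_nls.
have nfB i y : i != y -> (i, y, true) \in nls P -> (y, i, true) \in nls P -> False.
  move=> hiy h1 h2; have b1 := nls_le h1.
  have [|C hC hB] := @dbB _ _ _ _ hdb i y; first by arith.
  by apply: (nf C hC) => l; rewrite hB !inE nl_neg => /orP[] /eqP ->.
have nfA i y k : [&& i != y, y != k & i != k] -> (i, y, true) \in nls P ->
    (y, k, true) \in nls P -> (i, k, false) \in nls P -> False.
  move=> hd h1 h2 h3; have b1 := nls_le h1; have b2 := nls_le h2.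
  have [|C hC hA] := @dbA _ _ _ _ hdb i y k; first by arith.
  by apply: (nf C hC) => l; rewrite hA !inE nl_neg => /or3P[] /eqP ->.
have nfC y k : known N (learned N (Ph 0 1)) y k ->
    (forall i, i <= k -> i != y -> (i, y, false) \in nls P) -> False.
  move=> hK h; apply: (nf _ (dbC hdb hK)) => l; rewrite in_colC nl_neg.
  by case: (nl l) => [[a b] s] /= /and4P[-> /eqP -> ha hk]; apply: h.
have h01 : (0, 1, true) \in nls P.
  have [|||i|//|h] := forcedC (i := 0) (y := 1) (k := 1) hdb hs hsub; rewrite ?K //; try lia.
  by case: (nfC 1 1) => [|[|[|i]]] //; rewrite K.
have h10 : (1, 0, false) \in nls P.
  by have [//||//] := forcedB (i := 1) hdb hs hsub h01; move/(nfB 0 1 isT h01).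
have h20 : (2, 0, true) \in nls P.
  have [|||[|[|[|i]]]|//|h] := forcedC (i := 2) (y := 0) (k := 2) hdb hs hsub; rewrite ?K //.
  by case: (nfC 0 2) => [|[|[|[|i]]]] //; rewrite K.
have h02 : (0, 2, false) \in nls P.
  by have [//||//] := forcedB (i := 0) hdb hs hsub h20; move/(nfB 2 0 isT h20).
have h12 : (1, 2, false) \in nls P.
  have [//|//|//|h|//] := forcedA (i := 1) hdb hs hsub h20 h10.
  by case: (nfA 1 2 0 isT h h20 h10).
by case: (nfC 2 2) => [|[|[|[|i]]]] //; rewrite K.
Qed.

Lemma learned_final : clauses_of N (learned N (Ph 0 1)) =
  head_clauses N.+1 ++ cascade_clauses N.+1 ++ tail_clauses N.+1.
Proof.
have cC y k : y <= k <= N -> colC N y k = clauseC N.+1 y.+1 k.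
  by move=> h; rewrite clauseC_colC.
rewrite /learned /clauses_of top0 -catA !map_cat; congr (_ ++ (_ ++ _)).
- by rewrite /head_pairs /= !cC ?leq_subr // !subSS.
- rewrite map_flatten /cascade_clauses -map_comp; congr flatten.
  have -> : downto (N.+1 - 2) 2 = map S (downto (N - 2) 1).
    by rewrite -downto_succ; congr downto; lia.
  rewrite -map_comp; apply/eq_in_map => y; rewrite mem_downto => hy /=.
  rewrite /block -map_comp !subSS subn0; apply/eq_in_map => k.
  by rewrite mem_downto => hk /=; rewrite cC //; lia.
- rewrite /tail_clauses -map_comp subSS; apply/eq_in_map => k.
  by rewrite mem_downto => hk /=; rewrite cC //; lia.
Qed.

Variables (R : realFieldType) (delta : R).
Hypotheses (d0 : (0 < delta)%R) (d2 : (delta <= 2%:R^-1)%R).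
Local Notation step := (cdcl_step delta F vars).

Definition search_inv ph P Q :=
  [/\ valid N ph, wf F (clauses_of N (learned N ph)) P Q
    & if terminal ph then level (P ++ Q) = 0 else
      advances delta (clauses_of N (learned N ph))
        (colC N (target N ph).1 (target N ph).2) P Q].

Lemma search_inv_start ph : valid N ph -> search_inv ph [::] [::].
Proof.
move=> hv; split=> //; first exact: wf_init.
by case: ifPn => // ht; apply: advances_phase.
Qed.

Variant search_result ph P Q : state var -> Prop :=
  | ResultSearch P' Q' of search_inv ph P' Q' & fuel P' Q' < fuel P Q :
      search_result ph P Q (Search (clauses_of N (learned N ph)) P' Q')
  | ResultLearn of search_inv (next_phase N ph) [::] [::] & remaining N (next_phase N ph) < remaining N ph :
      search_result ph P Q (Search (clauses_of N (learned N (next_phase N ph))) [::] [::])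
  | ResultUnsat of terminal ph : search_result ph P Q (Unsat (clauses_of N (learned N ph))).

Lemma search_inv_step ph P Q s :
  search_inv ph P Q -> step (Search (clauses_of N (learned N ph)) P Q) s ->
  search_result ph P Q s.
Proof.
case=> hv hwf; case: ifPn => ht hadv hs; last first.
  case: (hadv) => I [hI hstep]; case: (hstep _ _ _ hwf hI hs) => [[P' [Q' [E hI']]]|E]; subst s.
    apply: ResultSearch (fuel_step hwf hs); split=> //; first exact: (wf_step hwf hs).
    by rewrite (negbTE ht); exists I.
  have [hv' hlt] := valid_next hN hv ht.
  have -> : rcons (clauses_of N (learned N ph)) (colC N (target N ph).1 (target N ph).2)
      = clauses_of N (learned N (next_phase N ph)).
    by rewrite (learned_next hN hv ht) /clauses_of map_rcons.
  by apply: ResultLearn => //; apply: search_inv_start.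
have eph : ph = Ph 0 1 by case: (ph) ht => [||[|q] [|[|k]]].
have hfuel P' Q' : s = Search (clauses_of N (learned N ph)) P' Q' ->
    wf F (clauses_of N (learned N ph)) P' Q' /\ fuel P' Q' < fuel P Q.
  move=> E; rewrite E in hs; split; last exact: fuel_step hwf hs.
  exact: (wf_step hwf hs).
case: (stepE hs) hfuel => [C l hC hu hhd|e Q' EQ hse|v EQ hse hch|C hC hf hl|C hC hf hl|EQ hse hall] hfuel.
- have [h1 h2] := hfuel _ _ (erefl _); apply: ResultSearch h2; split=> //; rewrite ht.
  by rewrite -rcons_cat -cats1 level_cat hadv.
- have [h1 h2] := hfuel _ _ (erefl _); apply: ResultSearch h2; split=> //; rewrite ht.
  by rewrite cat_rcons -EQ.
- by case: (@refuted P); rewrite -eph.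
- by rewrite hadv in hl.
- exact: ResultUnsat.
- by case: (@refuted P); rewrite -eph.
Qed.

Lemma search_terminates b k ph P Q :
  2 * #|var| < b -> search_inv ph P Q -> remaining N ph * b + fuel P Q < k ->
  cdcl_terminates_from delta F vars (Search (clauses_of N (learned N ph)) P Q).
Proof.
move=> hb; elim: k ph P Q => [|k IH] ph P Q hinv; first by rewrite ltn0.
rewrite ltnS => hk; constructor => s hs.
case: (search_inv_step hinv hs) => [P' Q' hinv' hlt|hinv' hlt|_].
- by apply: IH hinv' (leq_trans _ hk); rewrite ltn_add2l.
- apply: IH hinv' (leq_trans _ (leq_trans (leq_addr _ _) hk)).
  apply: (@leq_trans ((remaining N (next_phase N ph)).+1 * b)).
    by rewrite mulSn addnC ltn_add2r /fuel /= subn0 addn0.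
  by rewrite leq_mul2r hlt orbT.
- by constructor => s' h; inversion h.
Qed.

Definition state_inv (s : state var) := match s with
  | Search L P Q => exists ph, L = clauses_of N (learned N ph) /\ search_inv ph P Q
  | Sat _ => False
  | Unsat L => L = clauses_of N (learned N (Ph 0 1))
  end.

Lemma state_inv_reachable s s' :
  Relation_Operators.clos_refl_trans_1n _ step s s' -> state_inv s -> state_inv s'.
Proof.
elim=> // {s s'} s s1 s' hs _ IH hinv; apply: IH; case: s hs hinv => [L P Q|L|L] hs.
- move=> [ph [E hinv]]; subst L.
  case: (search_inv_step hinv hs) => [P' Q' h _|h _|ht] /=.
  + by exists ph.
  + by exists (next_phase N ph).
  + by case: (ph) ht => [||[|q] [|[|k]]].
- by inversion hs.
- by inversion hs.
Qed.

End Main.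

Theorem theorem4 (n : nat) (R : realFieldType) (delta : R) :
  6 <= n -> (0 < delta)%R -> (delta <= 2%:R^-1)%R ->
  cdcl_terminates_from delta (OP n) (op_vars n) (cdcl_init (op_var n))
  /\ (forall s : state (op_var n),
        cdcl_reachable delta (OP n) (op_vars n) s ->
        cdcl_halted delta (OP n) (op_vars n) s ->
        s = Unsat (head_clauses n ++ cascade_clauses n ++ tail_clauses n)).
Proof.
case: n => [|N] hN d0 d2; first by rewrite ltn0 in hN.
have hinit := search_inv_start hN d0 d2 (ph := H0) isT.
split; first exact: (search_terminates hN d0 d2 (ltnSn _) hinit (ltnSn _)).
move=> s hreach hhalt.
have : state_inv delta s.
  by apply: (state_inv_reachable hN d0 d2 hreach); exists H0.
case: s hreach hhalt => [L P Q|L|L] _ hhalt //.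
  by case=> ph [E [_ hwf _]]; subst L; have [s hs] := progress delta (op_vars N.+1) hwf; case: (hhalt _ hs).
by move=> E; rewrite -(learned_final hN); congr Unsat; exact: E.
Qed.
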